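(* For every integer $n>1$ there exists a weak solenoid $X_n$ such that: the union of all leaves of $X_n$ with exactly $1$ end is a residual subset of $X_n$; the union of all leaves of $X_n$ with exactly $2$ ends is a meager subset of $X_n$, and the number of leaves with $2$ ends is uncountable; and there is a single leaf of $X_n$ with $2n$ ends.
   Context: A weak solenoid is an inverse limit $X_\infty=\varprojlim\{f^i_{i-1}:X_i\to X_{i-1},\ i\ge 1\}$, where each $X_i$ is a closed (compact, without boundary) connected manifold and each bonding map $f^i_{i-1}$ is a finite-to-one covering map of index greater than one. The projection $X_\infty\to X_0$ is a fibre bundle with Cantor set fibre, and $X_\infty$ is a compact foliated space, locally homeomorphic to (Euclidean disk)$\times$(Cantor set). The leaves of $X_\infty$ are its path-connected components; each leaf is given the leaf topology (generated by the open plaques, i.e. the sets corresponding to (open disk)$\times\{\text{point}\}$ in local charts), in which it is a connected manifold covering $X_0$. The number of ends of a leaf is the cardinality of its (Freudenthal) space of ends in the leaf topology. A subset of $X_\infty$ is meager if it is a countable union of nowhere dense sets and residual if its complement is meager. *)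

(* Defs.v *)
From HB Require Import structures.
From mathcomp Require Import all_boot all_order all_algebra.
From mathcomp Require Import all_classical all_reals all_analysis.

Set Implicit Arguments.
Unset Strict Implicit.
Unset Printing Implicit Defensive.

Import Order.TTheory GRing.Theory Num.Theory.
Import numFieldNormedType.Exports.

Local Open Scope classical_set_scope.
Local Open Scope ring_scope.

Definition nowhere_dense (T : topologicalType) (A : set T) : Prop :=
  interior (closure A) = set0.

Definition meager (T : topologicalType) (A : set T) : Prop :=
  exists2 F : nat -> set T, (forall i, nowhere_dense (F i)) & A = \bigcup_i F i.

Definition residual (T : topologicalType) (A : set T) : Prop := meager (~` A).

(* For D open: f restricts to a homeomorphism from D onto the open set f(D). *)
Definition open_embedding_on (T U : topologicalType) (D : set T) (f : T -> U) :
    Prop :=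
  [/\ {within D, continuous f},
      {in D &, injective f} &
      forall A, open A -> A `<=` D -> open (f @` A)].

(* The norm of 'rV[R]_d is the sup norm, hence the explicit sum of squares. *)
Definition open_disk (R : realType) (d : nat) : set 'rV[R]_d :=
  [set v | \sum_(i < d) v ord0 i ^+ 2 < 1].
Arguments open_disk : clear implicits.

Definition locally_euclidean (R : realType) (d : nat) (M : topologicalType) :
    Prop :=
  forall x : M, exists phi : 'rV[R]_d -> M,
    open_embedding_on (open_disk R d) phi /\ (phi @` open_disk R d) x.

Definition closed_connected_manifold (R : realType) (d : nat)
    (M : topologicalType) : Prop :=
  [/\ hausdorff_space M, @second_countable M & locally_euclidean R d M] /\
  [/\ compact [set: M], connected [set: M] & [set: M] !=set0].

(* U is evenly covered: f^-1(U) is a disjoint union of open sets, each of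
   which f maps homeomorphically onto U. *)
Definition evenly_covered (M N : topologicalType) (f : M -> N) (U : set N) :
    Prop :=
  exists S : set (set M),
    [/\ trivIset S id,
        \bigcup_(V in S) V = f @^-1` U &
        forall V, S V ->
          [/\ open V, open_embedding_on V f & f @` V = U]].

Definition covering_map (M N : topologicalType) (f : M -> N) : Prop :=
  [/\ continuous f, range f = setT &
      forall x : N, exists2 U, open_nbhs x U & evenly_covered f U].

Definition covering_index (M N : Type) (f : M -> N) (k : nat) : Prop :=
  forall x : N, (f @^-1` [set x] #= `I_k)%card.

(* [ws_bond i] is the bonding map from the (i+1)-st manifold to the i-th one. *)
Record weak_solenoid (R : realType) := WeakSolenoid {
  ws_dim : nat;
  ws_space : nat -> topologicalType;
  ws_bond : forall i, ws_space i.+1 -> ws_space i;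
  ws_manifold : forall i, closed_connected_manifold R ws_dim (ws_space i);
  ws_covering : forall i, covering_map (@ws_bond i);
  ws_index : forall i, exists2 k, (1 < k)%N & covering_index (@ws_bond i) k
}.

Definition ws_threads (R : realType) (S : weak_solenoid R) :
    set (prod_topology (ws_space S)) :=
  [set x | forall i, @ws_bond R S i (x i.+1) = x i].
Arguments ws_threads {R} S.

Definition ws_limit (R : realType) (S : weak_solenoid R) : topologicalType :=
  set_type (ws_threads S).

Section path_components.
Variables (R : realType) (T : topologicalType).

Definition path_joined (x y : T) : Prop :=
  exists g : R -> T,
    [/\ {within `[0, 1], continuous g}, g 0 = x & g 1 = y].

Definition path_component (x : T) : set T := [set y | path_joined x y].

End path_components.

Definition leaf (R : realType) (S : weak_solenoid R) (L : set (ws_limit S)) :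
    Prop :=
  exists x, L = path_component R x.

Definition foliated_chart (R : realType) (S : weak_solenoid R)
    (phi : 'rV[R]_(ws_dim S) * cantor_space -> ws_limit S) : Prop :=
  open_embedding_on (open_disk R (ws_dim S) `*` [set: cantor_space]) phi.

Definition plaque (R : realType) (S : weak_solenoid R) (P : set (ws_limit S)) :
    Prop :=
  exists phi (c : cantor_space), foliated_chart phi /\
    P = phi @` (open_disk R (ws_dim S) `*` [set c]).

(* [set_type L] carries the topology induced from the solenoid; the copy below
   carries instead the leaf topology, generated by the plaques inside L. *)
Definition leaf_space (R : realType) (S : weak_solenoid R)
    (L : set (ws_limit S)) : Type := set_type L.

Section leaf_topology.
Variables (R : realType) (S : weak_solenoid R) (L : set (ws_limit S)).

HB.instance Definition _ := Choice.on (leaf_space L).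

Definition leaf_plaque : set (set (leaf_space L)) :=
  [set Q | exists2 P, plaque P /\ P `<=` L & Q = set_val @^-1` P].

HB.instance Definition _ :=
  @isSubBaseTopological.Build (leaf_space L) (set (leaf_space L))
    leaf_plaque id.

End leaf_topology.

(* The inverse limit, over the compact subsets K of T, of the sets of connected
   components of the complement of K. *)
Definition ends (T : topologicalType) :
    set ({K : set T | compact K} -> set T) :=
  [set e |
    (forall K, exists2 x, (~` sval K) x &
       e K = connected_component (~` sval K) x) /\
    (forall K K', sval K `<=` sval K' -> e K' `<=` e K)].
Arguments ends : clear implicits.

Definition leaf_with_ends (R : realType) (S : weak_solenoid R) (m : nat) :
    set (set (ws_limit S)) :=
  [set L | leaf L /\ (ends (leaf_space L) #= `I_m)%card].
Arguments leaf_with_ends {R} S m.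

(* Main.v *)
(** Let M = 2n.  The surface X_m is glued from 2^m copies, indexed by binary
    words of length m, of a square with M - 1 square holes: the j-th boundary
    circle of the copy w is glued by an antipodal flip to the j-th boundary
    circle of the copy a_j w, for M involutions a_j acting on words compatibly
    with truncation.  The corresponding graph Gamma_m on words is a tree with
    loops, M of which are marked; Gamma_(m+1) consists of two copies of Gamma_m
    joined by an edge that unfolds the 0-th marked loop.  Truncation gives double
    coverings X_(m+1) -> X_m, and the leaves of the limit correspond to the
    binary sequences b up to cofinality.

    A leaf is exhausted by compact cores (the copies indexed by the sequences that
    agree with b from rank m on), and the components of the complement of a core
    are indexed by those of the M marks of Gamma_m through which later cores are
    reached; these are computed by composing maps delta_(b_m), delta_(b_(m+1)),
    ... on the M marks, where delta_0 is a cyclic shift and delta_1 only takes the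
    values 0 and 1.  Hence there is one end if the pattern 11 occurs infinitely often,
    which is a residual condition; there are at most two ends if 1 occurs
    infinitely often, and M ends if b is eventually 0, which is a single leaf.
    Finally, concatenations of blocks 1 0^(M-1) and 0^M, with infinitely many of
    the former, give uncountably many leaves with exactly two ends. *)

Require Import Defs.
From HB Require Import structures.
From mathcomp Require Import finmap all_boot all_order all_algebra.
From mathcomp Require Import all_classical all_reals all_analysis.
From mathcomp Require Import zify ring lra.

Set Implicit Arguments.
Unset Strict Implicit.
Unset Printing Implicit Defensive.

Import Order.TTheory GRing.Theory Num.Theory.
Import numFieldNormedType.Exports.

Local Open Scope classical_set_scope.

(** * Words and their Schreier graphs *)

(** A loop of Gamma_m glues a collar to itself, so the gluing map must be an involution without
    fixed points; hence the antipodal flips. A loop then gives a crosscap instead of a boundary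
    circle, and opening it into an edge keeps the gluing rule, so truncating words is a covering.

    The marks form a queue: stage m+1 consumes mark 0, moves the others up by one and appends one
    mark of the new copy, which keeps their number equal to M. If b_m = 0, only the appended mark
    lies beyond mark 0, whence the cyclic shift; if b_m = 1, only the appended mark lies in the
    stage itself, whence the values 0 and 1. As M > 2, the label 1 is not the last one, so delta_1
    applied twice gives 0.

    The predicate [glued] holds both for the surfaces X_m and for the leaves in the leaf topology,
    so separation, connectedness and components of complements are treated once. For a leaf the
    obstacle is that the leaf topology is generated by the plaques of all possible charts; total
    disconnectedness of the Cantor factor confines connected sets to single plaques. *)

Section words.
Variable K : nat.
Local Notation label := 'I_K.+3.

Fixpoint word (m : nat) : finType :=
  if m is m'.+1 then (word m' * bool)%type else unit.

(** The mark of stage m lying under the mark c of stage m+1. The value 0 is omitted, since that loop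
    is unfolded; the value 1 is taken at 0 and at the last label, whose marks sit in different
    copies. *)
Definition parent (c : label) : label :=
  if c == ord_max then inord 1 else inord c.+1.

Lemma parentE (c : label) :
  parent c = (if (c : nat) == K.+2 then 1%N else c.+1) :> nat.
Proof.
rewrite /parent -val_eqE /=; case: eqP => [_|/eqP cK]; rewrite inordK //.
by have := ltn_ord c; lia.
Qed.

Lemma parent_neq0 (c : label) : parent c != ord0.
Proof. by rewrite -val_eqE /= parentE; case: ifP. Qed.

(* The c-th marked loop of the graph of stage m is attached to [mark m c] and
   labelled by [mark_label m c]. The marks of stage m.+1 are those of the copy
   [false] of stage m, except the unfolded one, followed by the mark 1 of the
   copy [true]. *)
Fixpoint mark (m : nat) : label -> word m :=
  match m with
  | 0 => fun _ => tt
  | m'.+1 => fun c => (mark m' (parent c), c == ord_max)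
  end.

Fixpoint mark_label (m : nat) (c : label) : label :=
  if m is m'.+1 then mark_label m' (parent c) else c.

Fixpoint act (m : nat) (j : label) : word m -> word m :=
  match m with
  | 0 => id
  | m'.+1 => fun w =>
    if (w.1 == mark m' ord0) && (j == mark_label m' ord0) then (w.1, ~~ w.2)
    else (act j w.1, w.2)
  end.
Arguments act : clear implicits.

(** Marks may share a vertex (all do at stage 0), so only vertex and label together determine a
    mark. Two marks over the same one differ in the last bit. *)
Lemma mark_inj m c c' :
  mark m c = mark m c' -> mark_label m c = mark_label m c' -> c = c'.
Proof.
elim: m c c' => [//|m IH] c c' /= [e1 e2] e3.
move: (IH _ _ e1 e3) => /(congr1 (@nat_of_ord _)); rewrite !parentE => e.
apply/val_inj => /=; move: e e2; rewrite -!val_eqE /=.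
by do 2!case: eqP => //; lia.
Qed.

(** A mark of stage m+1 lies over a mark other than 0, hence over a loop that has not been
    unfolded. *)
Lemma act_mark m c : act m (mark_label m c) (mark m c) = mark m c.
Proof.
elim: m c => [//|m IH] c /=.
rewrite IH; case: ifP => // /andP[/eqP e1 /eqP e2].
by have /eqP := mark_inj e1 e2; rewrite (negbTE (parent_neq0 c)).
Qed.

(** In the branch that flips the last bit, the edge below is a marked loop, so truncation does not
    see the flip. *)
Lemma act_fst m j (w : word m.+1) : (act m.+1 j w).1 = act m j w.1.
Proof. by rewrite /=; case: ifP => //= /andP[/eqP-> /eqP->]; rewrite act_mark. Qed.

Lemma actK m j : involutive (act m j).
Proof.
elim: m j => [//|m IH] j [w x] /=.
case: (boolP ((w == mark m ord0) && _)) => [h|nh] /=; first by rewrite h negbK.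
case: ifP => /= [/andP[/eqP e /eqP ej]|_]; last by rewrite IH.
by move: nh; rewrite -(IH j w) e ej act_mark !eqxx.
Qed.

Fixpoint prefix (b : nat -> bool) (m : nat) : word m :=
  match m with 0 => tt | m'.+1 => (prefix b m', b m') end.
Arguments prefix : clear implicits.

Lemma prefix_fst b m : (prefix b m.+1).1 = prefix b m. Proof. by []. Qed.

Lemma eq_prefix b b' m :
  prefix b m = prefix b' m <-> (forall i, (i < m)%N -> b i = b' i).
Proof.
elim: m => [//|m IH] /=; split=> [[/IH e1 e2] i|e].
  by rewrite ltnS leq_eqVlt => /orP[/eqP->//|/e1].
by rewrite (e m)//; congr pair; apply/IH => i im; apply: e; rewrite ltnS ltnW.
Qed.

Fixpoint splice (m : nat) : word m -> (nat -> bool) -> nat -> bool :=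
  match m with
  | 0 => fun _ b => b
  | m'.+1 => fun w b => splice w.1 (fun i => if i == m' then w.2 else b i)
  end.

Lemma splice_ge m (w : word m) b i : (m <= i)%N -> splice w b i = b i.
Proof.
elim: m w b => [//|m IH] w b /= mi; rewrite IH; last exact: ltnW.
by case: eqP => // e; move: mi; rewrite e ltnn.
Qed.

Lemma eq_prefix_lt b b' m : (forall i, (i < m)%N -> b i = b' i) ->
  prefix b m = prefix b' m.
Proof. by move/eq_prefix. Qed.

Lemma prefix_splice m (w : word m) b : prefix (splice w b) m = w.
Proof.
elim: m w b => [|m IH] /=; first by case.
by case=> w x b /=; rewrite IH splice_ge// eqxx.
Qed.

Lemma splice_unique m (w : word m) b b' : prefix b m = w ->
  (forall i, (m <= i)%N -> b i = b' i) -> b = splice w b'.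
Proof.
move=> e1 e2; apply/funext => i; have [mi|im] := leqP m i.
  by rewrite splice_ge// e2.
by have /eq_prefix -> : prefix b m = prefix (splice w b') m by rewrite prefix_splice.
Qed.

Lemma word_of_thread (t : forall m, word m) :
  (forall m, (t m.+1).1 = t m) -> exists b, forall m, prefix b m = t m.
Proof.
move=> tE; exists (fun m => (t m.+1).2); elim=> [|m IH] /=; first by case: (t 0).
by rewrite IH -tE; case: (t m.+1).
Qed.

(** * The action on infinite binary sequences *)

Definition actw (j : label) (b : nat -> bool) : nat -> bool :=
  fun m => (act m.+1 j (prefix b m.+1)).2.

Lemma prefix_actw j b m : prefix (actw j b) m = act m j (prefix b m).
Proof.
elim: m => [//|m IH]; rewrite [LHS]/= IH -(prefix_fst b m) -act_fst.
by rewrite [RHS]surjective_pairing.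
Qed.

Lemma prefix_ext b b' : (forall m, prefix b m = prefix b' m) -> b = b'.
Proof. by move=> e; apply/funext => i; have [] := e i.+1. Qed.

Lemma actwK j : involutive (actw j).
Proof. by move=> b; apply: prefix_ext => m; rewrite !prefix_actw actK. Qed.

(** A bit flips only at mark 0 of its stage, which is a loop of that stage, so no earlier bit moves.
    Hence an edge changes at most one bit and stays within a cofinality class. *)
Lemma actw_flip j b m : actw j b m != b m ->
  [/\ prefix b m = mark m ord0, j = mark_label m ord0 &
      forall i, (i < m)%N -> actw j b i = b i].
Proof.
rewrite /actw /=; case: ifP => [/andP[/eqP e /eqP ej] _|]; last by rewrite eqxx.
split=> //; apply/eq_prefix.
by rewrite prefix_actw e ej act_mark.
Qed.

Lemma actw_tail j b m : act m j (prefix b m) != prefix b m ->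
  forall i, (m <= i)%N -> actw j b i = b i.
Proof.
move=> ne i mi; apply/eqP; apply: contraNT ne => /actw_flip[e ej el].
by apply/eqP; rewrite -prefix_actw; apply: eq_prefix_lt => k km; apply: el; lia.
Qed.

Lemma actw_one_bit j b : exists m, forall i, i != m -> actw j b i = b i.
Proof.
have [[m mP]|no] := pselect (exists m, actw j b m != b m).
  exists m => i im; apply/eqP; apply/negPn/negP => iP.
  have [_ _ el] := actw_flip mP; have [_ _ el'] := actw_flip iP.
  by case: (ltngtP i m) im => // h _;
    [rewrite el ?eqxx in iP|rewrite el' ?eqxx in mP].
by exists 0 => i _; apply/eqP/negPn/negP => iP; apply: no; exists i.
Qed.

Lemma actw_mark b m (j := mark_label m ord0) : prefix b m = mark m ord0 ->
  actw j b = splice (mark m ord0 : word m) (fun i => if i == m then ~~ b m else b i).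
Proof.
move=> e; have fl : actw j b m = ~~ b m by rewrite /actw /= e !eqxx.
apply: splice_unique => [|i mi]; first by rewrite prefix_actw e act_mark.
case: eqP => [->//|/eqP im].
have [k kP] := actw_one_bit j b; have mk : m = k.
  by apply/eqP/negPn/negP => /kP; rewrite fl; case: (b m).
by apply: kP; rewrite -mk.
Qed.

Definition cofinal (b b' : nat -> bool) : Prop :=
  exists m, forall i, (m <= i)%N -> b' i = b i.

Lemma cofinal_refl b : cofinal b b. Proof. by exists 0. Qed.

Lemma cofinal_sym b b' : cofinal b b' -> cofinal b' b.
Proof. by case=> m e; exists m => i /e. Qed.

Lemma cofinal_trans b2 b1 b3 : cofinal b1 b2 -> cofinal b2 b3 -> cofinal b1 b3.
Proof.
case=> m e [m' e']; exists (maxn m m') => i; rewrite geq_max => /andP[h h'].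
by rewrite e'// e.
Qed.

Lemma cofinal_actw j b : cofinal b (actw j b).
Proof.
by have [m mP] := actw_one_bit j b; exists m.+1 => i mi; apply: mP; lia.
Qed.

(** A path in the Schreier graph whose vertices, both ends included, avoid [G]; later [G] indexes
    the copies forming a compact core. *)
Inductive chain (V : Type) (J : Type) (a : J -> V -> V) (G : set V) : V -> V -> Prop :=
| chain_refl v : ~ G v -> chain a G v v
| chain_step v j w : ~ G v -> chain a G (a j v) w -> chain a G v w.

Section chain_lemmas.
Context {V J : Type} {a : J -> V -> V} {G : set V}.
Hypothesis aK : forall j, involutive (a j).

Lemma chain_l v w : chain a G v w -> ~ G v.
Proof. by case. Qed.

Lemma chain_r v w : chain a G v w -> ~ G w.
Proof. by elim. Qed.

Lemma chain_trans w v u : chain a G v w -> chain a G w u -> chain a G v u.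
Proof. by elim=> // {}v j {}w Gv _ IH h; apply: chain_step Gv (IH h). Qed.

Lemma chain_sym v w : chain a G v w -> chain a G w v.
Proof.
elim=> [{}v Gv|{}v j {}w Gv vw IH]; first exact: chain_refl.
apply: chain_trans IH _; apply: (@chain_step _ _ _ _ _ j); first exact: chain_l vw.
by rewrite aK; exact: chain_refl.
Qed.

Lemma chain_sub (H : set V) v w : (forall u, H u -> G u) -> chain a G v w -> chain a H v w.
Proof.
move=> HG; elim=> [{}v Gv|{}v j {}w Gv _ IH].
  by apply: chain_refl => /HG.
by apply: chain_step IH => /HG.
Qed.
End chain_lemmas.

(** In the graph of the leaf of [b] these vertices form a copy of Gamma_m, some of whose marked
    loops have opened into edges leaving it. *)
Definition stage (b : nat -> bool) (m : nat) : set (nat -> bool) :=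
  [set b' | forall i, (m <= i)%N -> b' i = b i].

Lemma stage_le b m m' : (m <= m')%N -> (stage b m `<=` stage b m')%classic.
Proof. by move=> mm b' h i /(leq_trans mm)/h. Qed.

Lemma stageS b m b' : stage b m.+1 b' -> b' m = b m -> stage b m b'.
Proof.
by move=> h e i; rewrite leq_eqVlt => /orP[/eqP<-//|]; exact: h.
Qed.

Lemma splice_act m (w : word m) j b : act m j w != w ->
  actw j (splice w b) = splice (act m j w) b.
Proof.
move=> ne; apply: splice_unique; first by rewrite prefix_actw prefix_splice.
by move=> i mi; rewrite (@actw_tail j _ m) ?prefix_splice// splice_ge.
Qed.

(** Both copies of Gamma_m inside Gamma_(m+1) are connected by induction, and the unfolded loop
    joins them. *)
Lemma chain_word m (w w' : word m) : chain (act m) set0 w w'.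
Proof.
elim: m w w' => [|m IH] /=.
  by do 2!case; exact: chain_refl.
have same (w w' : word m) x : chain (act m.+1) set0 (w, x) (w', x).
  elim: (IH w w') => [v _|v j v' _ _ IH']; first exact: chain_refl.
  case/boolP: ((v == mark m ord0) && (j == mark_label m ord0)) => [/andP[/eqP e /eqP ej]|ne].
    by move: IH'; rewrite e ej act_mark.
  by apply: (@chain_step _ _ _ _ _ j) => //=; rewrite (negbTE ne).
have flip x : chain (act m.+1) set0 (mark m ord0, x) (mark m ord0, ~~ x).
  apply: (@chain_step _ _ _ _ _ (mark_label m ord0)) => //=.
  by rewrite !eqxx /=; exact: chain_refl.
case=> w x [w' x']; have [->|/eqP ne] := eqVneq x x'; first exact: same.
apply: chain_trans (same w (mark m ord0) x) _.
apply: chain_trans (flip x) _.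
by have -> : ~~ x = x' by [case: x x' ne => -[]]; exact: same.
Qed.

Lemma chain_splice m (w w' : word m) b (G : set (nat -> bool)) :
  (forall u : word m, ~ G (splice u b)) -> chain actw G (splice w b) (splice w' b).
Proof.
move=> H; elim: (chain_word w w') => [v _|v j v' _ _ IH]; first exact: chain_refl.
have [e|ne] := eqVneq (act m j v) v; first by rewrite e in IH.
by apply: (@chain_step _ _ _ _ _ j) => //; rewrite splice_act.
Qed.

(** * Directions: the components of the complement of a stage *)

Section directions.
Variable b : nat -> bool.

(* The mark of stage m through which the copy x of stage m reaches the c-th mark of
   stage m.+1: the latter lies in the copy c == ord_max, and the way to the other
   copy goes through the mark 0. *)
Definition delta (x : bool) (c : label) : label :=
  if (c == ord_max) == x then parent c else ord0.

(** The composite of delta_(b_m), ..., delta_(b_(m+len-1)): the mark of stage m through which the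
    mark [c] of stage m+len is reached. *)
Fixpoint dir (m len : nat) (c : label) : label :=
  if len is l.+1 then delta (b m) (dir m.+1 l c) else c.

Lemma dirD m l l' c : dir m (l + l') c = dir m l (dir (m + l) l' c).
Proof. by elim: l m => [|l IH] m /=; rewrite ?addn0// IH addSnnS. Qed.

Definition across (m : nat) (c : label) : nat -> bool :=
  actw (mark_label m c) (splice (mark m c) b).

(** The other copy of Gamma_m inside stage m+1. The shells of rank at least m partition the part of
    the leaf outside stage m. *)
Definition shell (m : nat) : set (nat -> bool) := [set b' | stage b m.+1 b' /\ b' m != b m].

Lemma shell_ex m b' : cofinal b b' -> ~ stage b m b' ->
  exists l, shell (m + l) b'.
Proof.
move=> [k kP] nst; have ex : exists k, `[< stage b k b' >] by exists k; apply/asboolP.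
case: (ex_minnP ex) => -[|k0] /asboolP k0P k0m.
  by case: nst; exact: stage_le k0P.
have mk : (m <= k0)%N.
  by rewrite leqNgt; apply/negP => k0m'; apply: nst; exact: stage_le k0m' _ k0P.
exists (k0 - m); rewrite subnKC//; split=> //; apply/negP => /eqP eb.
by have /asboolP/k0m := stageS k0P eb; rewrite ltnn.
Qed.

Lemma shell_uniq m m' b' : shell m b' -> shell m' b' -> m = m'.
Proof.
wlog mm' : m m' / (m < m')%N.
  by move=> H h h'; case: (ltngtP m m') => // lt; [exact: H|exact/esym/H].
by move=> [h _] [_ /negP[]]; apply/eqP; apply: h.
Qed.

Lemma shell_notin m b' : shell m b' -> ~ stage b m b'.
Proof. by move=> [_ /negP h] st; apply: h; apply/eqP/st. Qed.

Lemma shell_splice m b' : shell m b' -> b' = splice (prefix b' m) (fun i => if i == m then ~~ b m else b i).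
Proof.
move=> [h ne]; apply: splice_unique => // i mi; case: eqP => [->|im].
  by case: (b' m) (b m) ne => -[].
by apply: h; lia.
Qed.

Lemma splice_shell m (w : word m) : shell m (splice w (fun i => if i == m then ~~ b m else b i)).
Proof.
split=> [i mi|]; rewrite splice_ge ?eqxx//; [|exact: ltnW|by case: (b m)].
by case: eqP mi => // ->; rewrite ltnn.
Qed.

Lemma chain_shell m b1 b2 : shell m b1 -> shell m b2 -> chain actw (stage b m) b1 b2.
Proof.
move=> /shell_splice-> /shell_splice->; apply: chain_splice => u.
exact/shell_notin/splice_shell.
Qed.

(** Mark 0 is the loop unfolded by the next stage, so crossing it flips bit m and leads into the
    other copy. *)
Lemma across0 m : shell m (across m ord0).
Proof.
rewrite /across actw_mark ?prefix_splice//; split=> [i mi|].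
  by rewrite splice_ge ?(ltnW mi)//; case: eqP mi => [->|_ mi]; rewrite ?ltnn// splice_ge// ltnW.
by rewrite !splice_ge// eqxx; case: (b m).
Qed.

(** By induction [b'] is joined, off stage m+1, to the far side of a mark c of stage m+1. If that
    mark lies in stage m, it is its mark [parent c]; otherwise it lies in shell m, and one steps
    back over it and walks inside the shell to the far side of mark 0. *)
Lemma chain_across m l b' : shell (m + l) b' ->
  chain actw (stage b m) b' (across m (dir m l ord0)).
Proof.
elim: l m => [|l IH] m rb /=.
  by rewrite addn0 in rb; apply: chain_shell rb _; exact: across0.
rewrite -addSnnS in rb; have := IH _ rb; set c := dir m.+1 l ord0 => h.
have {}h : chain actw (stage b m) b' (across m.+1 c).
  by apply: chain_sub h; exact: stage_le.
have sE : splice (mark m.+1 c) b =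
    splice (mark m (parent c)) (fun i => if i == m then c == ord_max else b i) by [].
rewrite /delta; case: eqP => ce.
  rewrite (_ : across m (parent c) = across m.+1 c) //; rewrite /across /= ce; congr actw; congr splice.
  by apply/funext => i; case: eqP => // ->.
have rc : shell m (splice (mark m.+1 c) b).
  rewrite sE (_ : (c == ord_max) = ~~ b m); last by case: eqP (b m) ce => ? [].
  exact: splice_shell.
apply: (chain_trans h); apply: (@chain_trans _ _ _ _ (splice (mark m.+1 c) b)).
  apply: (chain_sym actwK); apply: (@chain_step _ _ _ _ _ (mark_label m.+1 c)); last first.
    by apply: chain_refl; exact: chain_r h.
  exact: shell_notin rc.
exact: chain_shell rc (across0 m).
Qed.

(** Such a mark lies in shell m, entered from stage m through mark 0: the bits above m agree with
    [b], so [delta] passes to parents, until bit m differs and yields 0. *)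
Lemma dir_mark m l c b' : shell m b' ->
  prefix b' (m + l.+1) = mark (m + l.+1) c -> dir m l.+1 c = ord0.
Proof.
move=> [st ne]; elim: l c => [|l IH] c.
  rewrite addn1 /= => -[_ e]; rewrite /delta -e.
  by case: eqP ne => // ->; rewrite eqxx.
rewrite -addn1 dirD addnA addn1 /= => -[e1 e2].
by rewrite /delta -e2 st ?eqxx; [exact: IH|lia].
Qed.

Definition heading (m : nat) (b' : nat -> bool) (c : label) : Prop :=
  exists2 l, shell (m + l) b' & c = dir m l ord0.

Lemma heading_ex m b' : cofinal b b' -> ~ stage b m b' -> exists c, heading m b' c.
Proof. by move=> cof /(shell_ex cof)[l ?]; exists (dir m l ord0), l. Qed.

Lemma heading_uniq m b' c c' : heading m b' c -> heading m b' c' -> c = c'.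
Proof.
by move=> [l r ->] [l' r' ->]; congr dir; apply: (@addnI m); exact: shell_uniq r r'.
Qed.

Lemma heading_notin m b' c : heading m b' c -> ~ stage b m b'.
Proof.
by move=> [l /shell_notin r _] st; apply: r; apply: stage_le st; exact: leq_addr.
Qed.

Lemma heading_dir m l b' c : heading (m + l) b' c -> heading m b' (dir m l c).
Proof. by move=> [k r ->]; exists (l + k); rewrite ?addnA// dirD. Qed.

(** An edge between two shells flips the higher bit, so it starts at mark 0 of stage m+k'. By
    [dir_mark] the part of the direction coming from the ranks m+k to m+k' is then 0. *)
Lemma dir_edge m k k' j b1 : shell (m + k) b1 -> shell (m + k') (actw j b1) ->
  (k < k')%N -> dir m k ord0 = dir m k' ord0.
Proof.
move=> r1 [_ ne] kk; have -> : k' = (k + (k' - k).-1.+1)%N by lia.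
rewrite dirD; congr dir; apply/esym/(dir_mark r1).
have -> : (m + k + (k' - k).-1.+1 = m + k')%N by lia.
have e : b1 (m + k') = b (m + k') by apply: r1.1; lia.
by have [|-> //] := @actw_flip j b1 (m + k'); rewrite e.
Qed.

(** Directions are constant along edges outside the stage, so they separate components;
    [chain_heading] gives the converse, that a direction is a single component. *)
Lemma heading_act m b' j c : heading m b' c -> ~ stage b m (actw j b') ->
  heading m (actw j b') c.
Proof.
move=> [l r ->] st.
have cof : cofinal b (actw j b').
  apply: (@cofinal_trans b'); last exact: cofinal_actw.
  by case: r => [h _]; exists (m + l).+1.
have [l' r'] := shell_ex cof st; exists l' => //.
have [ll|ll|-> //] := ltngtP l l'; first exact: dir_edge r r' ll.
by apply/esym; apply: (@dir_edge _ _ _ j _ r' _ ll); rewrite actwK.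
Qed.

Lemma chain_heading m b' c : heading m b' c ->
  chain actw (stage b m) b' (across m c).
Proof. by move=> [l r ->]; exact: chain_across. Qed.

Lemma across_heading m l : heading m (across (m + l) ord0) (dir m l ord0).
Proof. by exists l => //; exact: across0. Qed.

Lemma delta_true c : delta true c = (if c == ord_max then inord 1 else ord0).
Proof. by rewrite /delta eqb_id /parent; case: (c == ord_max). Qed.

Lemma delta_falseE c : delta false c = c.+1 %% K.+3 :> nat.
Proof.
rewrite /delta eqbF_neg; case: eqP => [->|/eqP c_max] /=; first by rewrite modnn.
rewrite parentE -val_eqE /= in c_max *; rewrite (negbTE c_max) modn_small//.
by have := ltn_ord c; lia.
Qed.

Lemma dir_false m l c : (forall i, (i < l)%N -> b (m + i) = false) ->
  dir m l c = (c + l) %% K.+3 :> nat.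
Proof.
elim: l m => [|l IH] m bF /=; first by rewrite addn0 modn_small.
have := bF 0 isT; rewrite addn0 => ->; rewrite delta_falseE IH => [|i il].
  by rewrite -addn1 modnDml addn1 addnS.
by rewrite addSnnS bF.
Qed.

Lemma heading_11 m b' c : b m -> b m.+1 -> heading m b' c -> c = ord0.
Proof.
move=> b0 b1 [[|[|l]] _ -> //=]; rewrite b0 ?b1 !delta_true //.
by rewrite ifF//; apply/negbTE; rewrite -val_eqE; case: ifP => _ /=; rewrite ?inordK.
Qed.

Lemma heading_1 m b' c : b m -> heading m b' c -> (c < 2)%N.
Proof.
move=> b0 [[|l] _ -> //=]; rewrite b0 delta_true.
by case: ifP; rewrite //= inordK.
Qed.
End directions.
End words.

(** * Ends of a space exhausted by compact subsets *)

Section ends.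
Variable T : topologicalType.
Local Notation compact_set := {A : set T | compact A}.

Lemma connected_component_mono (A B : set T) x : A `<=` B ->
  connected_component A x `<=` connected_component B x.
Proof. by move=> AB y [C [Cx CA cC] Cy]; exists C => //; split=> // z /CA/AB. Qed.

Lemma end_component (e : compact_set -> set T) (A : compact_set) p : ends T e ->
  e A p -> e A = connected_component (~` sval A) p.
Proof.
by move=> [h _]; have [x _ ->] := h A => /same_connected_component.
Qed.

Lemma end_nonempty (e : compact_set -> set T) (A : compact_set) : ends T e ->
  exists2 p, e A p & (~` sval A) p.
Proof.
by move=> [h _]; have [x Ax ->] := h A; exists x => //; exact: connected_component_refl.
Qed.

Lemma end_eq (e e' : compact_set -> set T) (A B : compact_set) :
  ends T e -> ends T e' -> sval A `<=` sval B -> e B = e' B -> e A = e' A.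
Proof.
move=> he he' AB eB; have [p ep _] := end_nonempty B he.
have [_ m] := he; have [_ m'] := he'.
rewrite (end_component he (m _ _ AB _ ep)); rewrite eB in ep.
by rewrite (end_component he' (m' _ _ AB _ ep)).
Qed.

Variable E : nat -> set T.
Hypothesis compactE : forall i, compact (E i).
Hypothesis leE : forall i, E i `<=` E i.+1.
Hypothesis absorbE : forall A, compact A -> exists i, A `<=` E i.
Let F i : compact_set := exist _ (E i) (@compactE i).

Lemma exhaust_mono i j : (i <= j)%N -> E i `<=` E j.
Proof.
elim: j => [|j IH]; first by rewrite leqn0 => /eqP->.
by rewrite leq_eqVlt => /orP[/eqP->//|/IH h]; apply: subset_trans h (@leE j).
Qed.

(** When the components outside [E i] are numbered compatibly with the inclusions, an end amounts to
    one number valid for all i, and its values on the [E i] determine it on every compact set. *)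
Lemma ends_card (N : nat) (P : nat -> nat -> set T) :
  (forall i p, ~ E i p -> exists2 c, (c < N)%N & P i c p) ->
  (forall i c, (c < N)%N -> P i c !=set0) ->
  (forall i c p, P i c p -> ~ E i p /\ connected_component (~` E i) p = P i c) ->
  (forall i c, (c < N)%N -> P i.+1 c `<=` P i c) ->
  (forall i c c' p, P i c p -> P i c' p -> c = c') ->
  (ends T #= `I_N)%card.
Proof.
move=> Pex P0 Pcomp Psub Puniq.
have Pmono i j c : (c < N)%N -> (i <= j)%N -> P j c `<=` P i c.
  move=> cN; elim: j => [|j IH]; first by rewrite leqn0 => /eqP->.
  rewrite leq_eqVlt => /orP[/eqP->//|/IH h]; apply: subset_trans h.
  exact: Psub.
have endP e i : ends T e -> exists2 c, (c < N)%N & e (F i) = P i c.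
  move=> he; have [p ep np] := end_nonempty (F i) he.
  have [c cN cp] := Pex _ _ np; exists c => //.
  by rewrite (end_component he ep); exact: (Pcomp _ _ _ cp).2.
pose f (e : compact_set -> set T) : nat := xget 0 [set c | (c < N)%N /\ e (F 0) = P 0 c].
have fP e : ends T e -> (f e < N)%N /\ forall i, e (F i) = P i (f e).
  move=> he; have [fN f0] : (f e < N)%N /\ e (F 0) = P 0 (f e).
    have [c cN ec] := endP e 0 he; rewrite /f.
    by case: xgetP => [d _ //|/(_ c) []].
  split=> // i; have [c cN ec] := endP e i he; rewrite ec; congr (P i).
  have [p cp] := P0 i c cN; apply: (Puniq 0 _ _ p); first exact: Pmono cp.
  have [_ m] := he; rewrite -f0; apply: (m _ (F i)); last by rewrite ec.
  exact: exhaust_mono.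
apply/(card_set_bijP (U := nat)); exists f; split.
- by move=> e /fP[].
- move=> e e'; rewrite !inE => he he' fe; apply/funext => A.
  have [i Ai] := absorbE (svalP A); apply: (@end_eq e e' A (F i)) => //.
  by rewrite (fP _ he).2 (fP _ he').2 fe.
move=> c cN.
have [pt ptP] := choice (fun i => P0 i c cN).
have [ix ixP] := choice (fun A : compact_set => absorbE (svalP A)).
(* The end with number [c]: absorb [A] in a set of the exhaustion and take the component through a
   point of [P (ix A) c]. [eE] shows that neither choice matters. *)
pose e (A : compact_set) := connected_component (~` sval A) (pt (ix A)).
have cmpE (A : compact_set) i j p : sval A `<=` E i -> (i <= j)%N -> P j c p ->
    connected_component (~` sval A) (pt i) p.
  move=> AE ij cp; apply: (@connected_component_mono (~` E i)); first exact: subsetC.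
  by rewrite (Pcomp _ _ _ (ptP i)).2; exact: Pmono cp.
have eE (A : compact_set) i p : sval A `<=` E i -> P i c p -> e A = connected_component (~` sval A) p.
  move=> AE cp; have m1 := cmpE A (ix A) (maxn (ix A) i) _ (@ixP A) (leq_maxl _ _) (ptP _).
  have m2 := cmpE A i (maxn (ix A) i) _ AE (leq_maxr _ _) (ptP _).
  rewrite /e (same_connected_component m1) -(same_connected_component m2).
  by apply: same_connected_component; exact: cmpE cp.
have he : ends T e.
  split=> [A|A B AB].
    exists (pt (ix A)) => // /ixP h; have [+ _] := Pcomp _ _ _ (ptP (ix A)); exact.
  rewrite (eE A (ix B) (pt (ix B))) //.
    exact/connected_component_mono/subsetC.
  exact: subset_trans AB (@ixP B).
exists e => //; have [fN fE] := fP _ he.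
apply: (Puniq 0 _ _ (pt 0)) => //; rewrite -fE (eE (F 0) 0 (pt 0))//.
by apply: connected_component_refl; have [] := Pcomp _ _ _ (ptP 0).
Qed.

(** Pigeonhole: three ends are pairwise separated by compact sets lying in a common [E j], whose
    complement is sorted by [s] into two classes, each within one component. *)
Lemma ends_not_card (N : nat) : (2 < N)%N ->
  (forall i, exists2 j, (i <= j)%N & exists s : T -> bool, forall p q,
     ~ E j p -> ~ E j q -> s p = s q -> connected_component (~` E j) p q) ->
  ~ (ends T #= `I_N)%card.
Proof.
move=> N2 few /(card_set_bijP (U := nat))[f [_ _ fs]].
have pick c : (c < 3)%N -> exists2 e, ends T e & f e = c.
  by move=> c3; have [e he ec] := fs c (leq_trans c3 N2); exists e.
have [e0 h0 f0] := pick 0 isT; have [e1 h1 f1] := pick 1 isT.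
have [e2 h2 f2] := pick 2 isT.
have split e e' : f e <> f e' -> exists A, e A <> e' A.
  by move=> ne; apply/existsNP => h; apply: ne; congr f; apply/funext.
have [A01 n01] : exists A, e0 A <> e1 A by apply: split; rewrite f0 f1.
have [A02 n02] : exists A, e0 A <> e2 A by apply: split; rewrite f0 f2.
have [A12 n12] : exists A, e1 A <> e2 A by apply: split; rewrite f1 f2.
have [i01 s01] := absorbE (svalP A01); have [i02 s02] := absorbE (svalP A02).
have [i12 s12] := absorbE (svalP A12).
have [j ij [s sP]] := few (maxn i01 (maxn i02 i12)).
move: ij; rewrite !geq_max => /and3P[l01 l02 l12].
have [p0 m0 k0] := end_nonempty (F j) h0; have [p1 m1 k1] := end_nonempty (F j) h1.
have [p2 m2 k2] := end_nonempty (F j) h2.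
have same e e' p p' (A : compact_set) i : ends T e -> ends T e' -> e (F j) p ->
    e' (F j) p' -> ~ E j p -> ~ E j p' -> sval A `<=` E i -> (i <= j)%N ->
    s p = s p' -> e A = e' A.
  move=> he he' ep ep' np np' Ai ij ss; apply: (@end_eq e e' A (F j)) => //.
    exact: subset_trans Ai (exhaust_mono ij).
  rewrite (end_component he ep) (end_component he' ep').
  exact: same_connected_component (sP _ _ np np' ss).
case S0 : (s p0); case S1 : (s p1); case S2 : (s p2);
  try (by apply: n01; apply: (same _ _ p0 p1 _ i01) => //; rewrite S0 S1);
  try (by apply: n02; apply: (same _ _ p0 p2 _ i02) => //; rewrite S0 S2);
  try (by apply: n12; apply: (same _ _ p1 p2 _ i12) => //; rewrite S1 S2).
Qed.

End ends.

Local Open Scope ring_scope.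

(** * Paths inside a subset *)

Section joined.
Variable R : realType.
Implicit Types T U : topologicalType.

Definition joined T (A : set T) (x y : T) : Prop :=
  exists g : R -> T, [/\ {within `[0, 1], continuous g}, g 0 = x, g 1 = y &
    forall t, 0 <= t <= 1 -> A (g t)].

Lemma joined_refl T (A : set T) x : A x -> joined A x x.
Proof.
by exists (fun=> x); split=> //; apply: continuous_subspaceT => t; exact: cvg_cst.
Qed.

Lemma joined_reparam T (A : set T) (g : R -> T) (h : R -> R) (B : set R) :
  {within `[0, 1], continuous g} -> {within B, continuous h} ->
  (forall t, B t -> 0 <= h t <= 1) -> {within B, continuous (g \o h)}.
Proof.
move=> gc hc hB; apply/subspace_continuousP => t Bt.
have /subspace_continuousP/(_ _ Bt) ht := hc.
have hI u : B u -> `[0, 1]%classic (h u) by rewrite /= in_itv /=; exact: hB.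
have /subspace_continuousP/(_ _ (hI _ Bt)) gt := gc.
move=> S /gt nS; have {}nS := ht _ nS.
rewrite /nbhs /= /within /= in nS *.
by apply: filterS nS => u uS Bu; apply: uS => //; exact: hI.
Qed.

Lemma within_continuous_eq T U (B : set T) (f g : T -> U) :
  (forall t, B t -> f t = g t) -> {within B, continuous g} -> {within B, continuous f}.
Proof.
move=> fg /subspace_continuousP gc; apply/subspace_continuousP => x Bx S.
rewrite /from_subspace fg// => /(gc x Bx) nS.
rewrite /nbhs /= /within /= in nS *.
by apply: filterS nS => u uS Bu; rewrite /from_subspace fg//; exact: uS.
Qed.

Lemma joined_sym T (A : set T) x y : joined A x y -> joined A y x.
Proof.
move=> [g [gc g0 g1 gA]]; exists (fun t => g (1 - t)).
have h (t : R) : 0 <= t <= 1 -> 0 <= 1 - t <= 1 by lra.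
split; rewrite ?subr0 ?subrr//; last by move=> t /h/gA.
apply: (joined_reparam A gc) => [|t]; last by rewrite /= in_itv; exact: h.
apply: continuous_subspaceT => t.
by apply: cvgB; [exact: cvg_cst|exact: cvg_id].
Qed.

Lemma joined_trans T (A : set T) y x z :
  joined A x y -> joined A y z -> joined A x z.
Proof.
move=> [g [gc g0 g1 gA]] [h [hc h0 h1 hA]].
pose f t := if t <= 2^-1 then g (2 * t) else h (2 * t - 1).
have fl t : t <= 2^-1 -> f t = g (2 * t) by rewrite /f => ->.
have fr t : 2^-1 <= t -> f t = h (2 * t - 1).
  rewrite le_eqVlt => /orP[/eqP<-|lt]; last by rewrite /f leNgt lt.
  by rewrite fl// divff ?subrr ?g1 ?h0// pnatr_eq0.
have itvE : `[0, 1]%classic = `[0, 2^-1] `|` `[2^-1, 1] :> set R.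
  apply/seteqP; split=> t /=; rewrite !in_itv /=; last by case; lra.
  by case: (leP t 2^-1) => ? ?; [left|right]; lra.
have hl (t : R) : `[0, 2^-1]%classic t -> 0 <= 2 * t <= 1 by rewrite /= in_itv /=; lra.
have hr (t : R) : `[2^-1, 1]%classic t -> 0 <= 2 * t - 1 <= 1 by rewrite /= in_itv /=; lra.
exists f; split.
- rewrite itvE; apply: withinU_continuous; try exact: interval_closed.
    apply: (@within_continuous_eq _ _ _ _ (fun t : R => g (2 * t))).
      by move=> t; rewrite /= in_itv /= => /andP[_ /fl].
    apply: (joined_reparam A gc _ hl); apply: continuous_subspaceT => t.
    exact: mulrl_continuous.
  apply: (@within_continuous_eq _ _ _ _ (fun t : R => h (2 * t - 1))).
    by move=> t; rewrite /= in_itv /= => /andP[/fr].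
  apply: (joined_reparam A hc _ hr); apply: continuous_subspaceT => t.
  by apply: cvgB; [exact: mulrl_continuous|exact: cvg_cst].
- by rewrite fl ?mulr0//; lra.
- by rewrite fr; [rewrite mulr1 (_ : 2 - 1 = 1)//; lra|lra].
move=> t t01; have [t2|t2] := leP t 2^-1; first by rewrite fl//; apply: gA; lra.
by rewrite fr ?ltW//; apply: hA; lra.
Qed.

Lemma joined_sub T (A B : set T) x y : A `<=` B -> joined A x y -> joined B x y.
Proof. by move=> AB [g [gc g0 g1 gA]]; exists g; split=> // t /gA/AB. Qed.

Lemma joined_image T U (A : set T) (B : set U) (f : T -> U) x y :
  (forall a, A a -> {for a, continuous f}) -> (forall a, A a -> B (f a)) ->
  joined A x y -> joined B (f x) (f y).
Proof.
move=> fc fB [g [gc g0 g1 gA]]; exists (f \o g); rewrite /= g0 g1; split=> //.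
  apply/subspace_continuousP => t t01.
  have /subspace_continuousP/(_ _ t01) gt := gc.
  apply: cvg_comp gt (fc _ (gA _ _)).
  by move: t01; rewrite /= in_itv.
by move=> t /gA/fB.
Qed.

Lemma joined_l T (A : set T) x y : joined A x y -> A x.
Proof. by move=> [g [_ <- _]]; apply; rewrite lexx ler01. Qed.

Lemma joined_component T (A : set T) x y :
  joined A x y -> connected_component A x y.
Proof.
move=> [g [gc g0 g1 gA]]; exists (g @` `[0, 1]).
  split; [by exists 0; rewrite //= in_itv /= ler01 lexx| |].
    by move=> _ [t + <-]; rewrite /= in_itv; exact: gA.
  by apply: connected_continuous_connected gc; exact: segment_connected.
by exists 1; rewrite //= in_itv /= ler01 lexx.
Qed.

Lemma joined_connected T (A : set T) x0 :
  (forall x, A x -> joined A x x0) -> connected A.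
Proof.
move=> AJ; suff -> : A = connected_component A x0 by exact: component_connected.
apply/seteqP; split; last exact: connected_component_sub.
by move=> x Ax; apply/joined_component/joined_sym/AJ.
Qed.

Lemma joined_path_joined T (A : set T) x y : joined A x y -> path_joined R x y.
Proof. by move=> [g [gc g0 g1 _]]; exists g. Qed.

End joined.

(** * The piece and the flips of its collars *)

Section geometry.
Variables (R : realType) (K : nat).
Local Notation label := 'I_K.+3.
Local Notation plane := 'rV[R]_2.

Lemma ord2P (i : 'I_2) : i = ord0 \/ i = ord_max.
Proof. by case: i => -[|[|//]] ilt; [left|right]; exact: val_inj. Qed.

Definition pt (s t : R) : plane := \row_i (if i == ord0 then s else t).

Lemma pt0 s t : pt s t ord0 ord0 = s. Proof. by rewrite mxE eqxx. Qed.
Lemma pt1 s t : pt s t ord0 ord_max = t. Proof. by rewrite mxE. Qed.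
Definition ptE := (pt0, pt1).

Lemma pt_eta (x : plane) : x = pt (x ord0 ord0) (x ord0 ord_max).
Proof.
by apply/rowP => i; rewrite mxE; case: (ord2P i) => ->.
Qed.

Definition centre (j : label) : R := (4 * j)%:R.
(** The holes have half-side 1 and centres 4 apart; the outer half-side 8 (K+3) is large enough for
    [collar_sep]. *)
Definition radius (j : label) : R := if j == ord0 then (8 * K.+3)%:R else 1.

(* The boundary circles of the piece are the squares gauge j = 1: the 0-th is the
   outer one, the others are unit squares around the points (4 j, 0). *)
Definition gauge (j : label) (x : plane) : R :=
  Num.max `|x ord0 ord0 - centre j| `|x ord0 ord_max| / radius j.

(* The truncation at 1/2 only avoids dividing by 0 near the centre of the outer square circle. *)
Definition height (j : label) (x : plane) : R :=
  if j == ord0 then (Num.max (gauge j x) 2^-1)^-1 else gauge j x.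

(** Inversion in the j-th boundary square for the sup norm, followed by the reflection in its
    centre: it inverts the gauge and is antipodal on the boundary circle. *)
Definition flip (j : label) (x : plane) : plane :=
  pt (centre j - (x ord0 ord0 - centre j) / gauge j x ^+ 2)
     (- x ord0 ord_max / gauge j x ^+ 2).

(** The bounds are inverse to each other, so the flip, which inverts heights, preserves the
    collar. *)
Definition collar (j : label) : set plane :=
  [set x | 3 / 4 < height j x /\ height j x < 4 / 3].
Definition piece : set plane := [set x | forall j, 1 <= height j x].
Definition thick_piece : set plane := [set x | forall j, 3 / 4 < height j x].

Lemma radius_gt0 j : 0 < radius j.
Proof. by rewrite /radius; case: ifP => // _; rewrite ltr0n. Qed.

Lemma height_gauge j x : collar j x ->
  height j x = (if j == ord0 then (gauge j x)^-1 else gauge j x) /\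
  3 / 4 < gauge j x < 4 / 3.
Proof.
rewrite /collar /height /=; case: eqP => _ [h1 h2]; last by rewrite h1 h2.
have : (Num.max (gauge j x) 2^-1)^-1 ^-1 > (4 / 3)^-1.
  by rewrite ltf_pV2// posrE ?invr_gt0 ?lt_max ?invr_gt0 ?ltr0n ?orbT//; lra.
have : (Num.max (gauge j x) 2^-1)^-1 ^-1 < (3 / 4)^-1.
  by rewrite ltf_pV2// posrE ?invr_gt0 ?lt_max ?invr_gt0 ?ltr0n ?orbT//; lra.
rewrite invrK; case: (leP (gauge j x) 2^-1) => h; last by lra.
by move=> _ ?; exfalso; lra.
Qed.

Lemma gauge_gt0 j x : collar j x -> 0 < gauge j x.
Proof. by move=> /height_gauge[_ /andP[h _]]; lra. Qed.

Lemma gauge_flip j x : 0 < gauge j x -> gauge j (flip j x) = (gauge j x)^-1.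
Proof.
move=> n0; set n := gauge j x; have rj := radius_gt0 j.
have nE : Num.max `|x ord0 ord0 - centre j| `|x ord0 ord_max| = n * radius j.
  by rewrite /n /gauge divfK// gt_eqF.
rewrite {1}/gauge /flip !ptE addrAC subrr sub0r mulNr !normrN.
rewrite -/n !normrM (@ger0_norm _ (n ^+ 2)^-1) ?invr_ge0 ?sqr_ge0//.
rewrite -maxr_pMl ?invr_ge0 ?sqr_ge0// nE; field.
by rewrite !gt_eqF.
Qed.

Lemma flipK j x : 0 < gauge j x -> flip j (flip j x) = x.
Proof.
move=> n0; rewrite {1}/flip gauge_flip// [RHS]pt_eta /flip !ptE.
by congr pt; field; rewrite gt_eqF.
Qed.

Lemma collar_flip j x : collar j x ->
  [/\ collar j (flip j x), height j (flip j x) = (height j x)^-1 &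
      flip j (flip j x) = x].
Proof.
move=> cx; have n0 := gauge_gt0 cx; have [hE /andP[n1 n2]] := height_gauge cx.
have m1 : (gauge j x)^-1 < 4 / 3 by rewrite invf_plt ?posrE//; lra.
have m2 : 3 / 4 < (gauge j x)^-1 by rewrite invf_pgt ?posrE//; lra.
have hE' : height j (flip j x) = (height j x)^-1.
  rewrite hE /height gauge_flip//; case: eqP => // _.
  by rewrite max_l//; lra.
split=> //; last exact: flipK.
by rewrite /collar /= hE' hE; case: ifP => _; rewrite ?invrK; split.
Qed.

(** A hole collar lies within 4/3 of its centre, and the centres are 4 apart. The outer collar
    begins at sup norm 6 (K+3), far from the holes, while near a hole the outer gauge is at most
    1/2, so that the truncated outer height is 2. *)
Lemma collar_sep i j x : collar j x -> i != j -> 4 / 3 < height i x.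
Proof.
move=> cx ij; have [_ /andP[n1 n2]] := height_gauge cx.
have cE k : centre k = 4 * k%:R by rewrite /centre natrM.
have K3 : (3 : R) <= (K.+3)%:R by rewrite ler_nat.
have ck (k : label) : k%:R + 1 <= (K.+3)%:R :> R.
  by have := ltn_ord k; rewrite -(ler_nat R) natr1.
have ck0 (k : label) : 0 <= k%:R :> R by rewrite ler0n.
move: n1 n2; rewrite /height /gauge /radius !cE natrM.
move: K3 ck; set k3 : R := (K.+3)%:R => K3 ck.
have r0 : 0 < 8 * k3 by lra.
have [ji|j0] := eqVneq j ord0; have [i0|i0] := eqVneq i ord0.
- by move: ij; rewrite i0 ji eqxx.
- rewrite divr1 ji mulr0 subr0 ltr_pdivlMr// => n1 n2.
  have hi := ck i; have hi0 := ck0 i; clear - n1 hi hi0 K3.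
  move: n1; rewrite !lt_max => /orP[] h; apply/orP; [left|right; lra].
  by move: h; rewrite !ltr_normr => /orP[] h; apply/orP; [left|right]; lra.
- rewrite divr1 i0 mulr0 subr0 => _ n2.
  rewrite gt_max in n2; case/andP: n2; rewrite !ltr_norml => /andP[a1 a2] /andP[a3 a4].
  have hj := ck j; have hj0 := ck0 j; clear - a1 a2 a3 a4 hj hj0 K3 r0.
  rewrite max_r; first by rewrite invrK; lra.
  by rewrite ler_pdivrMr// ge_max !ler_norml; apply/andP; split; apply/andP; split; lra.
- rewrite !divr1 !gt_max => _ /andP[]; rewrite !ltr_norml => /andP[a1 a2] _.
  rewrite lt_max ltr_normr.
  have : (i : nat)%:R + 1 <= (j : nat)%:R :> R \/ (j : nat)%:R + 1 <= (i : nat)%:R :> R.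
    by rewrite !natr1 !ler_nat; move: ij; rewrite -val_eqE /=; lia.
  clear - a1 a2.
  by case=> h; apply/orP; left; apply/orP; [left|right]; lra.
Qed.

(** With n the gauge, the displacement along the dominant coordinate is n + 1/n times the radius,
    and n + 1/n is at least 2. So the flip never identifies two points of a ball of radius at most
    1. *)
Lemma flip_far j x : collar j x -> 2 <= `|x - flip j x|.
Proof.
move=> cx; have n0 := gauge_gt0 cx; set n := gauge j x in n0.
have r1 : 1 <= radius j by rewrite /radius; case: ifP => // _; rewrite ler1n.
have nE : Num.max `|x ord0 ord0 - centre j| `|x ord0 ord_max| = n * radius j.
  by rewrite /n /gauge divfK// gt_eqF// radius_gt0.
have le k : `|(x - flip j x) ord0 k| <= `|x - flip j x|.
  by rewrite [leRHS]/Num.Def.normr /= mx_normrE; apply: (le_bigmax _ _ (ord0, k)).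
have amgm : 2 * n <= n ^+ 2 + 1.
  by have := sqr_ge0 (n - 1); rewrite sqrrB1 mulr2n; lra.
have key a : `|a| = n * radius j -> 2 <= `|a * (1 + (n ^+ 2)^-1)|.
  move=> aE; rewrite normrM aE (@ger0_norm _ (1 + _)) ?addr_ge0 ?invr_ge0 ?sqr_ge0//.
  have -> : n * radius j * (1 + (n ^+ 2)^-1) = radius j * ((n ^+ 2 + 1) / n).
    by field; rewrite gt_eqF.
  have : 2 <= (n ^+ 2 + 1) / n by rewrite ler_pdivlMr.
  by move=> h; apply: (le_trans h); rewrite ler_peMl// (le_trans _ h).
have [h|h] := leP `|x ord0 ord0 - centre j| `|x ord0 ord_max|.
  apply: le_trans (le ord_max); rewrite !mxE /= -/n.
  have -> : x ord0 ord_max - - x ord0 ord_max / n ^+ 2 = x ord0 ord_max * (1 + (n ^+ 2)^-1).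
    by field; rewrite gt_eqF.
  by apply: key; rewrite -nE max_r.
apply: le_trans (le ord0); rewrite !mxE eqxx -/n.
have -> : x ord0 ord0 - (centre j - (x ord0 ord0 - centre j) / n ^+ 2) =
    (x ord0 ord0 - centre j) * (1 + (n ^+ 2)^-1) by field; rewrite gt_eqF.
by apply: key; rewrite -nE max_l// ltW.
Qed.

Lemma pt_continuous (T : topologicalType) (f g : T -> R) x :
  {for x, continuous f} -> {for x, continuous g} ->
  {for x, continuous (fun z => pt (f z) (g z))}.
Proof.
move=> fs gt A [P HP PA]; have := HP ord0 ord0; have := HP ord0 ord_max.
rewrite ptE => /gt P1; rewrite ptE => /fs P0.
change (nbhs x ((fun z => pt (f z) (g z)) @^-1` A)).
change (nbhs x (f @^-1` P ord0 ord0)) in P0.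
change (nbhs x (g @^-1` P ord0 ord_max)) in P1.
apply: filterS2 P0 P1 => z P0 P1; apply: PA => i j; rewrite (ord1 i).
by have [->|->] := ord2P j; rewrite ptE.
Qed.

Lemma coordB_continuous i (c : R) : continuous (fun x : plane => x ord0 i - c).
Proof.
move=> x; have h := @coord_continuous R 1 2 ord0 i x.
exact: (@cvgB _ _ _ _ _ _ _ _ _ h (cvg_cst c)).
Qed.

Lemma gauge_continuous j : continuous (gauge j).
Proof.
move=> x; have n0 := cvg_norm (FF := nbhs_filter x) (@coordB_continuous ord0 (centre j) x).
have n1 := cvg_norm (FF := nbhs_filter x) (@coord_continuous R 1 2 ord0 ord_max x).
have mc := continuous_max n0 n1.
exact: (continuousM mc (@cst_continuous _ _ (radius j)^-1 x)).
Qed.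

Lemma height_continuous j : continuous (height j).
Proof.
move=> x; rewrite /height; case: eqP => _; last exact: gauge_continuous.
have m0 : (gauge j \max (fun=> 2^-1)) x != 0.
  by rewrite gt_eqF//= lt_max invr_gt0 ltr0n orbT.
exact: (continuousV m0 (continuous_max (@gauge_continuous j x)
  (@cst_continuous _ _ (2^-1 : R) x))).
Qed.

Lemma flip_continuous j x : collar j x -> {for x, continuous (flip j)}.
Proof.
move=> /gauge_gt0 n0.
have g0 : gauge j x * gauge j x != 0 by rewrite mulf_neq0 ?gt_eqF.
have gc := @gauge_continuous j x.
have nV := continuousV (s := gauge j \* gauge j) g0 (continuousM gc gc).
have c0 := continuousM (@coordB_continuous ord0 (centre j) x) nV.
exact: pt_continuous (continuousB (@cst_continuous _ _ (centre j) x) c0)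
  (continuousM (continuousN (@coord_continuous R 1 2 ord0 ord_max x)) nV).
Qed.

Lemma collar_open j : open (collar j).
Proof.
rewrite (_ : collar j = height j @^-1` [set r | 3 / 4 < r] `&`
  height j @^-1` [set r | r < 4 / 3])//.
have /continuousP hc := @height_continuous j.
exact: (openI (hc _ (@open_gt R (3 / 4))) (hc _ (@open_lt R (4 / 3)))).
Qed.

Lemma thick_piece_open : open thick_piece.
Proof.
rewrite openE => x Ux.
apply: (@filter_forall _ _ (fun j => [set y | 3 / 4 < height j y]) _ (nbhs_filter x)) => j.
exact: (@height_continuous j x _ (open_nbhs_nbhs (conj (@open_gt R (3 / 4)) (Ux j)))).
Qed.

Lemma piece_thick : piece `<=` thick_piece.
Proof. by move=> x Px j; have := Px j; lra. Qed.

Lemma collar_thick j : collar j `<=` thick_piece.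
Proof.
move=> x cx i; have [->|ij] := eqVneq i j; first by case: cx.
by have := collar_sep cx ij; lra.
Qed.

(** A thick point outside the piece is beyond exactly one boundary circle, and flipping there brings
    it inside. Hence the closed pieces already cover the glued space. *)
Lemma thick_flip x : thick_piece x ->
  piece x \/ exists j, collar j x /\ piece (flip j x).
Proof.
move=> tx; have [px|/existsNP[j /negP]] := pselect (piece x); first by left.
rewrite -ltNge => h1; right; have cx : collar j x by split; [exact: tx|lra].
have [cy hy _] := collar_flip cx; exists j; split=> // i.
have [->|ij] := eqVneq i j; last by have := collar_sep cy ij; lra.
by rewrite hy invf_ge1 ?ltW//; have := tx j; lra.
Qed.

Lemma collar_uniq i j x : collar i x -> collar j x -> i = j.
Proof.
by move=> [_ h] cj; apply/eqP/negPn/negP => /(collar_sep cj); lra.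
Qed.

Lemma height0_ge1 x : (1 <= height ord0 x) =
  (`|x ord0 ord0| <= radius ord0) && (`|x ord0 ord_max| <= radius ord0).
Proof.
rewrite /height eqxx invf_ge1 ?lt_max ?invr_gt0 ?ltr0n ?orbT//.
rewrite ge_max [X in _ && X](_ : _ = true) ?andbT; last by rewrite invf_le1// ler1n.
by rewrite /gauge ler_pdivrMr ?radius_gt0// mul1r ge_max /centre muln0 subr0.
Qed.

Lemma height0_gt1 x : (1 < height ord0 x) =
  (`|x ord0 ord0| < radius ord0) && (`|x ord0 ord_max| < radius ord0).
Proof.
rewrite /height eqxx invf_gt1 ?lt_max ?invr_gt0 ?ltr0n ?orbT//.
rewrite gt_max [X in _ && X](_ : _ = true) ?andbT; last by rewrite invf_lt1// ltr1n.
by rewrite /gauge ltr_pdivrMr ?radius_gt0// mul1r gt_max /centre muln0 subr0.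
Qed.

Lemma height_ge1 j x : j != ord0 -> (1 <= height j x) =
  (1 <= `|x ord0 ord0 - centre j|) || (1 <= `|x ord0 ord_max|).
Proof. by move=> /negbTE j0; rewrite /height /gauge /radius j0 divr1 le_max. Qed.

Lemma height_gt1 j x : j != ord0 -> (1 < height j x) =
  (1 < `|x ord0 ord0 - centre j|) || (1 < `|x ord0 ord_max|).
Proof. by move=> /negbTE j0; rewrite /height /gauge /radius j0 divr1 lt_max. Qed.

Lemma radius0_gt2 : 2 < radius ord0.
Proof.
rewrite /radius eqxx natrM; have : (3 : R) <= (K.+3)%:R by rewrite ler_nat.
by set k3 : R := (K.+3)%:R; lra.
Qed.

Lemma piece_compact : compact piece.
Proof.
set r := radius ord0.
apply: (@subclosed_compact _ _ [set x : plane | forall i, `[(- r), r]%classic (x ord0 i)]).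
- rewrite (_ : piece = \bigcap_(j in setT) (height j @^-1` [set t | 1 <= t])).
    apply: closed_bigI => j _.
    have /continuous_closedP := @height_continuous j.
    by apply; exact: closed_ge.
  by apply/seteqP; split=> x h j => [_|]; exact: h.
- apply: (@rV_compact _ _ (fun=> `[(- r), r]%classic)) => _; exact: segment_compact.
- move=> x /(_ ord0); rewrite height0_ge1 -!/r => /andP[x0 x1] i.
  rewrite /= in_itv /= -ler_norml.
  by have [->|->] := ord2P i.
Qed.

(** A path in this set touches only boundary circles through [x]; the copies across the other
    circles may have been removed. *)
Definition inner (x : plane) : set plane :=
  [set y | forall j, 1 <= height j y /\ (1 < height j x -> 1 < height j y)].

Lemma height_origin j : 1 < height j 0.
Proof.
have [->|j0] := eqVneq j ord0.
  by rewrite height0_gt1 !mxE normr0 andbb radius_gt0.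
rewrite height_gt1// !mxE sub0r normrN ger0_norm ?ler0n// /centre ltr1n.
by move: j0; rewrite -val_eqE /=; lia.
Qed.

Lemma segment_cont (a b : R) : continuous (fun u : R => a + u * (b - a)).
Proof.
move=> u; apply: cvgD; first exact: cvg_cst.
by apply: cvgM; [exact: cvg_id|exact: cvg_cst].
Qed.

Lemma joined_segment (A : set plane) s t s' t' :
  (forall u, 0 <= u <= 1 -> A (pt (s + u * (s' - s)) (t + u * (t' - t)))) ->
  joined R A (pt s t) (pt s' t').
Proof.
move=> H; exists (fun u => pt (s + u * (s' - s)) (t + u * (t' - t))); split.
- apply: continuous_subspaceT => u.
  exact: (pt_continuous (@segment_cont s s' u) (@segment_cont t t' u)).
- by rewrite !mul0r !addr0.
- by rewrite !mul1r !(addrC _ (_ - _)) !subrK.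
- exact: H.
Qed.

Lemma innerI x a b : piece x -> `|a| <= `|x ord0 ord0| ->
  `|b| <= `|x ord0 ord_max| \/ `|b| <= 2 ->
  (forall j, j != ord0 -> [\/ a = x ord0 ord0 /\ (`|x ord0 ord_max| <= `|b| \/ 2 <= `|b|),
    1 < `|b| | 1 < `|a - centre j|]) ->
  inner x (pt a b).
Proof.
move=> Px ax bx far j; have r2 := radius0_gt2.
have [->|j0] := eqVneq j ord0.
  have := Px ord0; rewrite height0_ge1 !height0_gt1 height0_ge1 !ptE.
  move=> /andP[h1 h2]; split; last move=> /andP[h3 h4]; apply/andP; split; case: bx; lra.
have := Px j; rewrite !height_ge1// !height_gt1// !ptE => Pj.
have [[-> [h|h]]|h|h] := far j j0.
- by split; [case/orP: Pj|case/orP] => h'; apply/orP; [left|right; lra|left|right; lra].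
- by split=> *; apply/orP; right; lra.
- by split=> *; apply/orP; right; lra.
- by split=> *; apply/orP; left; lra.
Qed.

(* Move vertically away from the holes, then horizontally to the axis that
   meets no hole, then along this axis to the origin. *)
Lemma piece_joined x : piece x -> joined R (inner x) x 0.
Proof.
(* Ordinates of absolute value 2 clear the unit holes; choosing [e] on the same side as the ordinate
   of [x] makes the absolute value vary linearly along the segment. *)
move=> Px; have [e [e2 te]] : exists e : R, `|e| = 2 /\ 0 <= x ord0 ord_max * e.
  have [t0|t0] := leP 0 (x ord0 ord_max).
    by exists 2; split; [rewrite ger0_norm|rewrite mulr_ge0].
  by exists (-2); split; [rewrite normrN ger0_norm|rewrite mulr_le0// ?ltW// oppr_le0].
set s := x ord0 ord0; set t := x ord0 ord_max in te.
apply: (@joined_trans _ _ _ (pt s e)).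
  rewrite [X in joined _ _ X _]pt_eta -/s -/t.
  apply: joined_segment => u /andP[u0 u1]; rewrite subrr mulr0 addr0.
  have bE : `|t + u * (e - t)| = `|t| + u * (2 - `|t|).
    have -> : t + u * (e - t) = (1 - u) * t + u * e by ring.
    have v0 : 0 <= 1 - u by lra.
    rewrite -e2; have [t0|t0] := leP 0 t; have [e0|e0] := leP 0 e.
    - rewrite !ger0_norm// ?addr_ge0 ?mulr_ge0//; ring.
    - have -> : t = 0 by move: e2; rewrite ltr0_norm// => ?; nra.
      by rewrite mulr0 add0r normr0 subr0 add0r normrM (ger0_norm u0).
    - have -> : e = 0 by nra.
      by rewrite mulr0 addr0 normr0 normrM (ger0_norm v0); ring.
    - rewrite !ler0_norm// ?(ltW t0) ?(ltW e0)//; first by ring.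
      by rewrite -oppr_ge0; nra.
  apply: innerI => //; rewrite bE; first by case: (leP `|t| 2) => h; [right|left]; nra.
  move=> j _; apply: Or31; split=> //.
  by case: (leP `|t| 2) => h; [left|right]; nra.
have -> : (0 : plane) = pt 0 0 by apply/rowP => i; rewrite !mxE; case: ifP.
apply: (@joined_trans _ _ _ (pt 0 e)).
  apply: joined_segment => u /andP[u0 u1]; rewrite subrr mulr0 addr0 sub0r.
  apply: innerI; rewrite ?e2//; [|by right|by move=> j _; apply: Or32; rewrite ltr1n].
  have -> : s + u * - s = (1 - u) * s by ring.
  by rewrite normrM ler_piMl// ger0_norm; lra.
apply: joined_segment => u /andP[u0 u1]; rewrite subrr mulr0 addr0 sub0r.
apply: innerI; rewrite ?normr0//.
  right; have -> : e + u * - e = (1 - u) * e by ring.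
  by rewrite normrM e2 ger0_norm; lra.
move=> j j0; apply: Or33; rewrite sub0r normrN ger0_norm ?ler0n// /centre ltr1n.
by move: j0; rewrite -val_eqE /=; lia.
Qed.

Definition rim (j : label) : plane := pt (centre j) (radius j).

Lemma height_rim j : height j (rim j) = 1.
Proof.
have gE : gauge j (rim j) = 1.
  rewrite /gauge !ptE subrr normr0 ger0_norm ?(ltW (radius_gt0 j))//.
  by rewrite max_r ?(ltW (radius_gt0 j))// divff// gt_eqF// radius_gt0.
rewrite /height gE; case: ifP => // _; rewrite max_l ?invr1//.
by rewrite invf_le1// ler1n.
Qed.

Lemma collar_rim j : collar j (rim j).
Proof. by rewrite /collar /= height_rim; lra. Qed.

Lemma height_rim_neq i j : i != j -> 1 < height i (rim j).
Proof. by move/(collar_sep (collar_rim j)); lra. Qed.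

Lemma piece_rim j : piece (rim j).
Proof.
move=> i; have [->|/height_rim_neq/ltW//] := eqVneq i j.
by rewrite height_rim.
Qed.

End geometry.

Section disks.
Variable R : realType.
Local Notation plane := 'rV[R]_2.
Local Notation disk := (@open_disk R 2).

Lemma disk_open : open disk.
Proof.
have -> : disk = (fun v : plane => v ord0 ord0 * v ord0 ord0 +
    v ord0 ord_max * v ord0 ord_max) @^-1` [set t | t < 1].
  apply/seteqP; split=> v; rewrite /open_disk /= big_ord_recr big_ord1 /= !expr2;
    by rewrite (_ : widen_ord _ _ = ord0)//; exact: val_inj.
have /continuousP hc : continuous (fun v : plane => v ord0 ord0 * v ord0 ord0 +
    v ord0 ord_max * v ord0 ord_max).
  move=> v; have c0 := @coord_continuous R 1 2 ord0 ord0 v.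
  have c1 := @coord_continuous R 1 2 ord0 ord_max v.
  exact: (@continuousD R R^o _ _ _ _ (continuousM c0 c0) (continuousM c1 c1)).
exact: (hc _ (@open_lt R 1)).
Qed.

Lemma disk0 : disk 0.
Proof. by rewrite /open_disk /= big1 ?ltr01// => i _; rewrite mxE expr0n. Qed.

Lemma disk_ball u : disk u -> `|u| < 1.
Proof.
rewrite /open_disk /= => h; rewrite /Num.Def.normr /= mx_normrE.
apply/bigmax_ltP; split=> // -[i j] _ /=; rewrite (ord1 i).
rewrite -[ltRHS]sqrtr1 -sqrtr_sqr ltr_sqrt//; apply: le_lt_trans h.
by rewrite (bigD1 j)//= lerDl sumr_ge0// => k _; exact: sqr_ge0.
Qed.

Definition dmap (x : plane) (d : R) (u : plane) : plane := x + d *: u.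

Lemma dmap0 x d : dmap x d 0 = x. Proof. by rewrite /dmap scaler0 addr0. Qed.

Lemma dmap_continuous x d : continuous (dmap x d).
Proof.
move=> u; apply: (@continuousD R plane _ _ _ _ (@cst_continuous _ _ x u)).
exact: scaler_continuous.
Qed.

Lemma dmap_ball x d u : 0 < d -> disk u -> ball x d (dmap x d u).
Proof.
move=> d0 /disk_ball u1; rewrite -ball_normE /= /dmap opprD addNKr normrN normrZ.
by rewrite gtr0_norm// gtr_pMr.
Qed.

Lemma dmap_inj x d : 0 < d -> injective (dmap x d).
Proof.
by move=> d0 u u' /addrI/(scalerI (lt0r_neq0 d0)).
Qed.

Lemma dmap_open x d A : 0 < d -> open A -> open (dmap x d @` A).
Proof.
move=> d0 oA; have -> : dmap x d @` A = (fun z => d^-1 *: (z - x)) @^-1` A.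
  apply/seteqP; split=> [_ [u Au <-]|z Az] /=.
    by rewrite /dmap addrAC subrr add0r scalerA mulVf ?scale1r// gt_eqF.
  exists (d^-1 *: (z - x)) => //; rewrite /dmap scalerA divff ?gt_eqF// scale1r.
  by rewrite addrC subrK.
have /continuousP : continuous (fun z : plane => d^-1 *: (z - x)).
  move=> z; have zc : {for z, continuous (@id plane)} by exact: cvg_id.
  have c1 := continuousB zc (@cst_continuous _ _ x z).
  exact: (continuous_comp c1 (@scaler_continuous R plane d^-1 _)).
exact.
Qed.

End disks.

Definition rat_ball (R : realType) (q : rat * rat * nat) : set 'rV[R]_2 :=
  ball (pt (ratr q.1.1) (ratr q.1.2)) (q.2.+1%:R^-1).

Arguments rat_ball : clear implicits.

Lemma rat_ball_basis (R : realType) (x : 'rV[R]_2) S : nbhs x S ->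
  exists2 q, rat_ball R q x & rat_ball R q `<=` S.
Proof.
move=> /nbhs_ballP[e /= e0 eS].
have [k k0 kP] : exists2 k : nat, True & (k.+1%:R^-1 *+ 2 : R) < e.
  exists (Num.truncn (2 / e)) => //; rewrite -[X in X < _]mulr_natl ltr_pdivrMr ?ltr0n//.
  rewrite mulrC -ltr_pdivrMr//; exact: truncnS_gt.
have ratE (t d : R) : 0 < d -> exists q : rat, `|ratr q - t| < d.
  move=> d0; have lt : t - d < t + d by lra.
  have [q] := rat_in_itvoo lt.
  by rewrite in_itv /= => /andP[h1 h2]; exists q; rewrite ltr_norml; apply/andP; split; lra.
have kV0 : 0 < k.+1%:R^-1 :> R by rewrite invr_gt0 ltr0n.
have [q0 h0] := ratE (x ord0 ord0) _ kV0; have [q1 h1] := ratE (x ord0 ord_max) _ kV0.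
have Bx : rat_ball R (q0, q1, k) x.
  split; first by rewrite /= invr_gt0 ltr0n.
  move=> i j; rewrite (ord1 i) -ball_normE /=.
  by have [->|->] := ord2P j; rewrite ptE.
exists (q0, q1, k) => //.
move=> z Bz; apply: eS; have := ball_triangle (ball_sym Bx) Bz.
by apply: le_ball; rewrite -mulr2n ltW.
Qed.

(** * Surfaces glued from copies of the piece *)

Section glued.
Variables (R : realType) (K : nat).
Local Notation label := 'I_K.+3.
Local Notation plane := 'rV[R]_2.
Local Notation thick := (@thick_piece R K).
Local Notation piece := (@piece R K).

(** For involutive [a j] this is already an equivalence on thick points, because collars are
    disjoint and flips are involutive. *)
Definition glue_rel (V : Type) (a : label -> V -> V) (v : V) (x : plane) (w : V) (y : plane) :=
  (v = w /\ x = y) \/ exists j, [/\ collar j x, y = flip j x & w = a j v].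

(* T is the union of the thick pieces indexed by D, the j-th collar of the copy v
   being glued by the flip to the j-th collar of the copy a j v. *)
Definition glued (V : Type) (D : set V) (a : label -> V -> V)
    (T : topologicalType) (psi : V -> plane -> T) : Prop :=
  [/\ forall p, exists v x, [/\ D v, piece x & p = psi v x],
      forall v x w y, D v -> D w -> thick x -> thick y ->
        psi v x = psi w y <-> glue_rel a v x w y &
      forall O, open O <-> forall v, D v -> open (thick `&` psi v @^-1` O)].

Section theory.
Variables (V : Type) (D : set V) (a : label -> V -> V).
Variables (T : topologicalType) (psi : V -> plane -> T).
Hypotheses (aK : forall j, involutive (a j)) (aD : forall j v, D v -> D (a j v)).
Hypothesis G : glued D a psi.

Lemma glued_flip v x j : D v -> collar j x -> psi v x = psi (a j v) (flip j x).
Proof.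
have [_ eqv _] := G; move=> Dv cx; have [cx' _ _] := collar_flip cx.
apply/eqv => //.
- exact: aD.
- exact: collar_thick cx.
- exact: collar_thick cx'.
- by right; exists j.
Qed.

Lemma psi_continuous v x : D v -> thick x -> {for x, continuous (psi v)}.
Proof.
have [_ _ op] := G; move=> Dv tx S; rewrite nbhsE => -[B [ oB Bx] BS].
have := iffLR (op B) oB v Dv; rewrite openE => /(_ x (conj tx Bx)).
by apply: filterS => z [_ /BS].
Qed.

Lemma psi_open v A : D v -> open A -> A `<=` thick -> open (psi v @` A).
Proof.
have [_ eqv op] := G; move=> Dv oA At; apply/op => w Dw; rewrite openE.
move=> y [ty [x Ax e]]; apply: filterI; first by apply: open_nbhs_nbhs; split=> //; exact: thick_piece_open.
have [[vw xy]|[j [cx yE wE]]] := (eqv _ _ _ _ Dv Dw (At _ Ax) ty).1 e.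
  have : nbhs y A by apply: open_nbhs_nbhs; split; rewrite // -xy.
  by apply: filterS => z Az; exists z => //; rewrite vw.
have [cy _ fy] := collar_flip cx; rewrite -yE in cy fy.
have : nbhs y (flip j @^-1` A `&` collar j).
  apply: filterI; last by apply: open_nbhs_nbhs; split=> //; exact: collar_open.
  apply: (flip_continuous cy); apply: open_nbhs_nbhs.
  by split=> //; rewrite fy.
apply: filterS => z [Az cz]; exists (flip j z) => //.
by rewrite (glued_flip Dw cz) wE aK.
Qed.

Lemma glued_rep p : exists v x, [/\ D v, piece x & p = psi v x].
Proof. by have [] := G. Qed.

Lemma glued_eq v x w y : D v -> D w -> thick x -> thick y ->
  psi v x = psi w y <-> glue_rel a v x w y.
Proof. by have [_ h _] := G; exact: h. Qed.

Lemma piece_rep v x : D v -> thick x ->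
  piece x \/ exists j, [/\ collar j x, piece (flip j x) & psi v x = psi (a j v) (flip j x)].
Proof.
move=> Dv /thick_flip[px|[j [cx py]]]; [by left|right].
by exists j; split=> //; exact: glued_flip.
Qed.

(** The gluing relation is closed on closed pieces, which stay away from the open ends of the
    collars; this gives the Hausdorff property. *)
Lemma not_glue_rel_near v x w y : piece x -> piece y -> ~ glue_rel a v x w y ->
  \forall z \near x & z' \near y, ~ glue_rel a v z w z'.
Proof.
move=> px py nr.
have sep (s t : plane) : s != t -> \forall s' \near s & t' \near t, s' <> t'.
  move=> st; have := @norm_hausdorff _ plane; rewrite open_hausdorff.
  move=> /(_ s t st)[[A B] /= [sA tB] [ oA oB AB]].
  rewrite !inE in sA tB.
  exists (A, B) => /=; first by split; apply: open_nbhs_nbhs; split.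
  move=> [s' t'] /= [As Bt] e; move/eqP: AB => /seteqP[/(_ s') + _]; apply.
  by split=> //; rewrite e.
have h1 : \forall z \near x & z' \near y, ~ (v = w /\ z = z').
  have [vw|vw] := pselect (v = w); last first.
    by near=> zz => -[].
  have /sep : x != y by apply: contra_notN nr => /eqP xy; left.
  by apply: filterS => -[z z'] /= zz [].
have h2 : \forall zz \near (x, y), forall j,
    ~ [/\ collar j zz.1, zz.2 = flip j zz.1 & w = a j v].
  apply: (@filter_forall _ _ (fun j => [set zz : plane * plane |
    ~ [/\ collar j zz.1, zz.2 = flip j zz.1 & w = a j v]]) _ (nbhs_filter (x, y))) => j.
  have [wE|wE] := pselect (w = a j v); last by near=> zz => -[].
  (* Glued points have inverse heights. If the product is 1, both heights, being at least 1, equal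
     1, so [x] is in the open collar where the flip is continuous; otherwise the product differs
     from 1 nearby too. *)
  have [h|h] := eqVneq (height j x * height j y) 1.
    have hx : height j x = 1 by have := px j; have := py j; nra.
    have cx : collar j x by rewrite /collar /= hx; lra.
    have /sep : flip j x != y by apply: contra_notN nr => /eqP <-; right; exists j.
    move=> [[A B] /= [nA nB] AB].
    exists (flip j @^-1` A, B) => /=; first by split=> //; exact: (flip_continuous cx).
    by move=> [z z'] /= [Az Bz] [_ e _]; exact: (AB (flip j z, z') (conj Az Bz)).
  have hc : {for (x, y), continuous (fun zz : plane * plane => height j zz.1 * height j zz.2)}.
    apply: (@continuousM R _ (fun zz : plane * plane => height j zz.1) (fun zz => height j zz.2)).
      exact: (@continuous_comp _ _ _ fst (@height R K j) (x, y) cvg_fst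
        (@height_continuous R K j x)).
    exact: (@continuous_comp _ _ _ snd (@height R K j) (x, y) cvg_snd
        (@height_continuous R K j y)).
  have : nbhs (x, y) [set zz : plane * plane | height j zz.1 * height j zz.2 != 1].
    apply: (hc [set t | t != 1]); apply: open_nbhs_nbhs.
    by split; [exact: (@open_neq R 1)|exact: h].
  apply: filterS => -[z z'] /= /eqP ne [cz e _]; apply: ne; rewrite e.
  have [_ -> _] := collar_flip cz; rewrite divff// gt_eqF//.
  by case: cz; lra.
apply: filterS2 h1 h2 => -[z z'] /= n1 n2 [//|[j]]; exact: n2.
Unshelve. all: by end_near.
Qed.

Lemma glued_hausdorff : hausdorff_space T.
Proof.
move=> p q cl; have [v [x [Dv px pE]]] := glued_rep p.
have [w [y [Dw py qE]]] := glued_rep q; apply: contrapT => pq.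
have tx := piece_thick px; have ty := piece_thick py.
have /(not_glue_rel_near px py)[[A B] /= [nA nB] AB] : ~ glue_rel a v x w y.
  by move/glued_eq => e; apply: pq; rewrite pE qE; exact: e.
have nbhs_psi u z C : D u -> thick z -> nbhs z C -> nbhs (psi u z) (psi u @` (C° `&` thick)).
  move=> Du tz nC; apply: open_nbhs_nbhs; split; last by exists z.
  apply: psi_open => //.
  by apply: openI; [exact: open_interior|exact: thick_piece_open].
rewrite pE qE in cl.
have [r [[z [Az tz] <-] [z' [Bz tz'] e]]] :=
  cl _ _ (nbhs_psi _ _ _ Dv tx nA) (nbhs_psi _ _ _ Dw ty nB).
by apply: (AB (z, z')); [split; exact: interior_subset|exact/glued_eq].
Qed.

Lemma psi_compact v A : D v -> A `<=` thick -> compact A -> compact (psi v @` A).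
Proof.
move=> Dv At cA; apply: continuous_compact cA; apply: continuous_in_subspaceT => x.
by rewrite inE => /At; exact: psi_continuous.
Qed.

Lemma psi_inj_ball v w x d z z' : D v -> D w -> d <= 1 -> ball x d `<=` thick ->
  ball x d z -> ball x d z' -> psi v z = psi w z' -> v = w /\ z = z'.
Proof.
move=> Dv Dw d1 bt bz bz' e; have [//|] := (glued_eq Dv Dw (bt _ bz) (bt _ bz')).1 e.
move=> [j [/flip_far far {}e _]]; exfalso; rewrite -e in far.
have := ball_triangle (ball_sym bz) bz'; rewrite -ball_normE /= => h.
by have := le_lt_trans far h; lra.
Qed.

Lemma good_radius x : thick x -> exists d : R, [/\ 0 < d, d <= 1 & ball x d `<=` thick].
Proof.
move=> tx; have : nbhs x thick by apply: open_nbhs_nbhs; split=> //; exact: thick_piece_open.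
move=> /nbhs_ballP[e /= e0 be]; exists (Num.min e 1); split.
- by rewrite lt_min e0 ltr01.
- by rewrite ge_min lexx orbT.
by move=> z h; apply: be; apply: le_ball h; rewrite ge_min lexx.
Qed.

Lemma psi_chart v x d : D v -> 0 < d -> d <= 1 -> ball x d `<=` thick ->
  open_embedding_on (open_disk R 2) (psi v \o dmap x d).
Proof.
move=> Dv d0 d1 bt; split.
- apply: continuous_in_subspaceT => u; rewrite inE => du.
  apply: continuous_comp; first exact: dmap_continuous.
  by apply: psi_continuous => //; apply: bt; exact: dmap_ball.
- move=> u u'; rewrite !inE => du du' /= e; apply: (dmap_inj d0 (x := x)).
  by have [] := psi_inj_ball Dv Dv d1 bt (dmap_ball x d0 du) (dmap_ball x d0 du') e.
- move=> A oA Ad; rewrite -image_comp; apply: psi_open => //; first exact: dmap_open.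
  by move=> _ [u /Ad du <-]; apply: bt; exact: dmap_ball.
Qed.

Lemma glued_locally_euclidean : locally_euclidean R 2 T.
Proof.
move=> p; have [v [x [Dv px ->]]] := glued_rep p.
have [d [d0 d1 bt]] := good_radius (piece_thick px).
exists (psi v \o dmap x d); split; first exact: psi_chart.
by exists 0; [exact: disk0|rewrite /= dmap0].
Qed.

(** * Components left after removing some copies *)

Section removed.
Variable C : set V.
Hypothesis CD : C `<=` D.

Definition copies : set T := \bigcup_(v in C) (psi v @` piece).

(** A point common to two closed pieces has inverse heights on both sides, both at least 1, so
    distinct copies meet only along boundary circles. *)
Lemma notin_copies v y : D v -> ~ C v -> piece y ->
  (forall j, C (a j v) -> 1 < height j y) -> ~ copies (psi v y).
Proof.
move=> Dv Cv py h [w Cw [z pz e]].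
have [[wv _]|[j [cz yE vE]]] :=
  (glued_eq (CD Cw) Dv (piece_thick pz) (piece_thick py)).1 e.
  by apply: Cv; rewrite -wv.
have [_ hy _] := collar_flip cz; rewrite -yE in hy.
have := h j; rewrite vE aK => /(_ Cw); rewrite hy.
have z1 := pz j.
by rewrite invf_gt1 ?(lt_le_trans ltr01 z1)// ltNge z1.
Qed.

Lemma copies_rim v y j : D v -> piece y -> C (a j v) -> ~ copies (psi v y) ->
  1 < height j y.
Proof.
move=> Dv py Cj ny; rewrite lt_neqAle py andbT; apply: contra_notN ny => /eqP hy.
have cy : collar j y by rewrite /collar /= -hy; lra.
have [cz hz _] := collar_flip cy.
exists (a j v) => //; exists (flip j y); last by rewrite (glued_flip Dv cy).
move=> i; have [->|ij] := eqVneq i j; first by rewrite hz -hy invr1.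
by have := collar_sep cz ij; lra.
Qed.

Lemma joined_copy v x : D v -> ~ C v -> piece x -> ~ copies (psi v x) ->
  joined R (~` copies) (psi v x) (psi v 0).
Proof.
move=> Dv Cv px nx; apply: joined_image (piece_joined px).
  move=> z hz; apply: psi_continuous => //; apply: piece_thick => j.
  by have [] := hz j.
move=> z hz; apply: notin_copies => // [j|j Cj]; first by have [] := hz j.
by have [_] := hz j; apply; exact: copies_rim nx.
Qed.

Lemma joined_edge v j : D v -> ~ C v -> ~ C (a j v) ->
  joined R (~` copies) (psi v 0) (psi (a j v) 0).
Proof.
move=> Dv Cv Cj; set y := rim R j; have py : piece y by exact: piece_rim.
have cy : collar j y by exact: collar_rim.
have ny : ~ copies (psi v y).
  apply: notin_copies => // i Ci; apply: height_rim_neq.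
  by apply: contra_not_neq Cj => <-.
apply: (joined_trans (joined_sym (joined_copy Dv Cv py ny))).
rewrite (glued_flip Dv cy); apply: joined_copy => //; first exact: aD.
  have [cz hz _] := collar_flip cy => i; have [->|ij] := eqVneq i j.
    by rewrite hz height_rim invr1.
  by have := collar_sep cz ij; lra.
by rewrite -(glued_flip Dv cy).
Qed.

Lemma joined_chain v w : D v -> chain a C v w ->
  joined R (~` copies) (psi v 0) (psi w 0).
Proof.
move=> Dv vw; elim: vw Dv => [{}v Cv|{}v j {}w Cv aw IH] Dv.
  apply: joined_refl; apply: notin_copies => // [j|j _]; [apply/ltW|];
  exact: height_origin.
apply: joined_trans (IH (aD _ Dv)); apply: joined_edge => //.
exact: chain_l aw.
Qed.

(* h labels the copies outside C by the component in which they lie, and [n c] is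
   a copy in the component c. *)
Variables (I : Type) (h : V -> I -> Prop) (n : I -> V).
Hypothesis copies_closed : closed copies.
Hypothesis h_uniq : forall v c c', h v c -> h v c' -> c = c'.
Hypothesis h_ex : forall v, D v -> ~ C v -> exists c, h v c.
Hypothesis h_notin : forall v c, h v c -> ~ C v.
Hypothesis h_act : forall v j c, D v -> h v c -> ~ C (a j v) -> h (a j v) c.
Hypothesis h_chain : forall v c, D v -> h v c -> chain a C v (n c).

Definition part (c : I) : set T :=
  [set p | ~ copies p /\ exists v x, [/\ D v, thick x, p = psi v x & h v c]].

Lemma part_ex p : ~ copies p -> exists c, part c p.
Proof.
move=> np; have [v [x [Dv px pE]]] := glued_rep p.
have Cv : ~ C v by move=> Cv; apply: np; rewrite pE; exists v => //; exists x.
have [c hc] := h_ex Dv Cv; exists c; split=> //.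
by exists v, x; split=> //; exact: piece_thick.
Qed.

Lemma part_uniq c c' p : part c p -> part c' p -> c = c'.
Proof.
move=> [np [v [x [Dv tx -> hv]]]] [_ [w [y [Dw ty e hw]]]].
have [[vw _]|[j [_ _ wE]]] := (glued_eq Dv Dw tx ty).1 e.
  by rewrite vw in hv; exact: h_uniq hv hw.
by apply: (h_uniq _ hw); rewrite wE; apply: h_act => //; rewrite -wE; exact: h_notin hw.
Qed.

Lemma part_open c : open (part c).
Proof.
rewrite openE => p [np [v [x [Dv tx pE hv]]]].
have oC : open (~` copies) by exact: closed_openC.
have oP : open (psi v @` thick `&` ~` copies).
  by apply: openI => //; apply: psi_open => //; exact: thick_piece_open.
have : nbhs p (psi v @` thick `&` ~` copies).
  by apply: open_nbhs_nbhs; split=> //; split=> //; exists x.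
by apply: filterS => _ [[z tz <-] nz]; split=> //; exists v, z.
Qed.

Lemma part_joined c p : part c p -> joined R (~` copies) p (psi (n c) 0).
Proof.
move=> [np [v [x [Dv tx pE hv]]]]; rewrite pE in np *.
have [px|[j [cx px e]]] := piece_rep Dv tx.
  apply: joined_trans (joined_copy Dv _ px np) _; first exact: h_notin hv.
  exact: joined_chain (h_chain _ hv).
have Cj : ~ C (a j v).
  by move=> Cj; apply: np; rewrite e; exists (a j v) => //; exists (flip j x).
have hj : h (a j v) c by exact: h_act.
rewrite e in np *; apply: joined_trans (joined_copy (aD _ Dv) Cj px np) _.
by apply: joined_chain (h_chain _ hj); exact: aD.
Qed.

(** The parts are open, disjoint and cover the complement, so a connected set stays in one of them;
    each part is path connected through the copy [n c]. *)
Lemma part_component c p : part c p -> connected_component (~` copies) p = part c.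
Proof.
move=> cp; apply/seteqP; split=> [q [B [Bp BC cB] Bq]|q cq].
  have Bq' := BC _ Bq; have [c' c'q] := part_ex Bq'.
  have e : B `&` part c = B.
    apply: cB; first by exists p.
      by exists (part c); [exact: part_open|].
    exists (~` \bigcup_(c' in [set c' | c' <> c]) part c').
      by apply: open_closedC; apply: bigcup_open => ? _; exact: part_open.
    apply/seteqP; split=> r [Br]; first by move=> cr; split=> // -[d dc /(part_uniq cr)] /esym.
    move=> nr; split=> //; have [d dr] := part_ex (BC _ Br).
    by have [<-//|dc] := pselect (d = c); exfalso; apply: nr; exists d.
  by move: Bq; rewrite -e => -[].
by apply: joined_component; exact: joined_trans (part_joined cp) (joined_sym (part_joined cq)).
Qed.

End removed.

(** A thick copy is covered by its own piece and the pieces of its finitely many neighbours, so each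
    point has a neighbourhood absorbed at a finite rank; compactness makes the rank uniform. *)
Lemma absorb_copies (C : nat -> set V) (A : set T) :
  (forall m, C m `<=` D) -> (forall m, C m `<=` C m.+1) ->
  (forall v, D v -> exists m, C m v) -> compact A -> exists m, A `<=` copies (C m).
Proof.
move=> CD CS Cex /compact_near_coveringP cA.
have Cmono i j : (i <= j)%N -> C i `<=` C j.
  elim: j => [|j IH]; first by rewrite leqn0 => /eqP->.
  rewrite leq_eqVlt => /orP[/eqP->//|/IH h].
  by apply: subset_trans h (CS j).
have : \forall m \near \oo, A `<=` copies (C m).
  apply: (cA nat \oo (fun m => copies (C m))) => p _.
  have [v [x [Dv px ->]]] := glued_rep p.
  have [mv mvP] := Cex _ Dv.
  have [f fP] := choice (fun j => Cex _ (aD j Dv)).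
  pose M := maxn mv (\max_j f j).
  have nb : nbhs (psi v x) (psi v @` thick).
    apply: open_nbhs_nbhs; split; last by exists x => //; exact: piece_thick.
    by apply: psi_open => //; exact: thick_piece_open.
  exists (psi v @` thick, [set m | (M <= m)%N]) => /=.
    by split=> //; exact: nbhs_infty_ge.
  move=> [q m] /= [[z tz <-] Mm]; have [pz|[j [cz pz ->]]] := piece_rep Dv tz.
    exists v; last by exists z.
    by apply: Cmono mvP; apply: leq_trans Mm; exact: leq_maxl.
  exists (a j v); last by exists (flip j z).
  apply: Cmono (fP j); apply: leq_trans Mm.
  exact: leq_trans (leq_bigmax j) (leq_maxr _ _).
by move=> [m _ /(_ m (leqnn m))]; exists m.
Qed.

Lemma copies_compact (W : finType) (f : W -> V) (C : set V) :
  C `<=` D -> C = range f -> compact (copies C).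
Proof.
move=> CD CE; have -> : copies C = \bigcup_(w in [set` enum W]) (psi (f w) @` piece).
  have -> : [set` enum W] = [set: W] by apply/seteqP; split=> w //= _; rewrite mem_enum.
  by rewrite /copies CE bigcup_image.
rewrite bigcup_seq; apply: bigsetU_compact => w _.
apply: psi_compact; [|exact: piece_thick|exact: piece_compact].
by apply: CD; rewrite CE; exists w.
Qed.

Lemma glued_compact (W : finType) (f : W -> V) : D = range f -> compact [set: T].
Proof.
move=> DE; have -> : [set: T] = copies D; last exact: (copies_compact (f := f)).
apply/seteqP; split=> p // _; have [v [x [Dv px ->]]] := glued_rep p.
by exists v => //; exists x.
Qed.

Lemma glued_joined v0 : D v0 -> (forall v, D v -> chain a set0 v v0) ->
  forall p, joined R setT p (psi v0 0).
Proof.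
move=> D0 h p; have [v [x [Dv px ->]]] := glued_rep p.
apply: (@joined_sub _ _ (~` copies set0)) => //.
have n0 q : ~ copies set0 q by move=> [].
by apply: joined_trans (joined_copy _ Dv _ px _) (joined_chain _ Dv (h _ Dv)).
Qed.

Lemma glued_connected v0 : D v0 -> (forall v, D v -> chain a set0 v v0) ->
  connected [set: T].
Proof. by move=> D0 h; apply: joined_connected => p _; exact: (glued_joined D0 h). Qed.

Lemma glued_second_countable (W : countType) (f : W -> V) : D = range f ->
  @second_countable T.
Proof.
move=> DE; have Df w : D (f w) by rewrite DE; exists w.
pose B (wq : W * (rat * rat * nat)) := psi (f wq.1) @` (rat_ball R wq.2 `&` thick).
have oB (q : rat * rat * nat) : open (rat_ball R q `&` thick).
  by apply: openI; [exact: ball_open|exact: thick_piece_open].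
exists (range B).
  apply: (@sub_countable _ _ _ [set: W * (rat * rat * nat)]); first exact: card_image_le.
  exact: countableP.
split=> [_ [q _ <-]|p S nS]; first by apply: psi_open.
have [v [x [Dv px pE]]] := glued_rep p; rewrite pE in nS *.
have tx := piece_thick px; have [q qx qS] := rat_ball_basis (psi_continuous Dv tx nS).
move: (Dv); rewrite DE => -[w _ wv]; exists (B (w, q)).
  by split; [exists (w, q)|rewrite /B /= wv; exists x].
by move=> _ [z [/qS + _] <-]; rewrite /= wv.
Qed.

End theory.

(** * Coverings induced by equivariant maps of index sets *)

Section maps.
Variables (V V' : Type) (D : set V) (D' : set V').
Variables (a : label -> V -> V) (a' : label -> V' -> V').
Variables (T T' : topologicalType) (psi : V -> plane -> T) (psi' : V' -> plane -> T').
Hypotheses (aK : forall j, involutive (a j)) (aD : forall j v, D v -> D (a j v)).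
Hypotheses (aK' : forall j, involutive (a' j)) (aD' : forall j v, D' v -> D' (a' j v)).
Hypotheses (G : glued D a psi) (G' : glued D' a' psi').
Variable f : V -> V'.
Hypotheses (fD : forall v, D v -> D' (f v)) (fa : forall j v, D v -> f (a j v) = a' j (f v)).

Lemma glued_map : exists g : T -> T', forall v x, D v -> thick x ->
  g (psi v x) = psi' (f v) x.
Proof.
have h p : exists vx : V * plane, [/\ D vx.1, thick vx.2 & p = psi vx.1 vx.2].
  have [v [x [Dv px pE]]] := glued_rep G p.
  by exists (v, x); split=> //; exact: piece_thick.
have [r rP] := choice h; exists (fun p => psi' (f (r p).1) (r p).2) => v x Dv tx.
have := rP (psi v x); case: (r (psi v x)) => u z /= [Du tz e].
apply/(glued_eq G') => //; [exact: fD|exact: fD|].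
have [[<- <-]|[j [cx xE vE]]] := (glued_eq G Du Dv tz tx).1 (esym e); first by left.
by right; exists j; split=> //; rewrite vE fa.
Qed.

Variable g : T -> T'.
Hypothesis gE : forall v x, D v -> thick x -> g (psi v x) = psi' (f v) x.

Lemma glued_map_continuous : continuous g.
Proof.
apply/continuousP => A oA; have [_ _ op] := G; have [_ _ op'] := G'.
apply/op => v Dv.
have -> : thick `&` psi v @^-1` (g @^-1` A) = thick `&` psi' (f v) @^-1` A.
  by apply/seteqP; split=> x [tx]; rewrite /= gE.
exact: ((op' A).1 oA _ (fD Dv)).
Qed.

Lemma glued_map_fibre w x p : D' w -> thick x -> g p = psi' w x ->
  exists v, [/\ D v, f v = w & p = psi v x].
Proof.
move=> Dw tx; have [v [y [Dv py ->]]] := glued_rep G p.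
have ty := piece_thick py; rewrite gE// => e.
have [[vw yx]|[j [cy xE wE]]] := (glued_eq G' (fD Dv) Dw ty tx).1 e.
  by exists v; rewrite -yx.
exists (a j v); rewrite fa// xE; split=> //; first exact: aD.
exact: (glued_flip aD G).
Qed.

Hypothesis fS : forall w, D' w -> exists2 v, D v & f v = w.

(** Over a ball of radius at most 1 in the copy [w], the sheets are the same ball in the copies [v]
    above [w]. *)
Lemma glued_map_covering : covering_map g.
Proof.
split; first exact: glued_map_continuous.
  apply/seteqP; split=> // q _; have [w [x [Dw px ->]]] := glued_rep G' q.
  have [v Dv <-] := fS Dw; exists (psi v x) => //.
  by rewrite gE//; exact: piece_thick.
move=> q; have [w [x [Dw px ->]]] := glued_rep G' q.
have [d [d0 d1 bt]] := good_radius (piece_thick px).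
have ob := @ball_open R 'rV[R]_2 x d.
exists (psi' w @` ball x d).
  split; first exact: (psi_open aK' aD' G').
  by exists x => //; exact: ballxx.
exists [set A | exists v, [/\ D v, f v = w & A = psi v @` ball x d]]; split.
- move=> A B [v [Dv vw ->]] [v' [Dv' vw' ->]] [_ [[z bz <-] [z' bz' e]]].
  by have [-> _] := psi_inj_ball G Dv' Dv d1 bt bz' bz e.
- apply/seteqP; split=> [_ [_ [v [Dv vw ->]] [z bz <-]]|p [z bz /esym e]].
    by exists z => //; rewrite -vw gE//; exact: bt.
  have [v [Dv vw ->]] := glued_map_fibre Dw (bt _ bz) e.
  by exists (psi v @` ball x d); [exists v|exists z].
- move=> _ [v [Dv vw ->]]; split.
  + exact: (psi_open aK aD G).
  + split.
    * by apply: continuous_subspaceT; exact: glued_map_continuous.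
    * move=> p p'; rewrite !inE => -[z bz <-] [z' bz' <-].
      rewrite !gE//; [|exact: bt|exact: bt]; rewrite vw => e.
      by have [_ ->] := psi_inj_ball G' Dw Dw d1 bt bz bz' e.
    * move=> A oA Ab; have -> : g @` A = psi' w @` (ball x d `&` (thick `&` psi v @^-1` A)).
        apply/seteqP; split=> [_ [p Ap <-]|_ [z [bz [tz Az]] <-]].
          have [z bz zE] := Ab _ Ap; exists z; last by rewrite -vw -gE ?zE//; exact: bt.
          by split=> //; split; [exact: bt|rewrite /= zE].
        by exists (psi v z) => //; rewrite gE// vw.
      apply: (psi_open aK' aD' G') => // [|z [bz _]]; last exact: bt.
      have [_ _ op] := G; apply: openI => //; exact: ((op A).1 oA _ Dv).
  + apply/seteqP; split=> [_ [_ [z bz <-] <-]|_ [z bz <-]].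
      by exists z => //; rewrite gE ?vw//; exact: bt.
    by exists (psi v z); [exists z|rewrite gE ?vw//; exact: bt].
Qed.

End maps.

(** * Existence of the glued space *)

Section glue_space.
Variables (V : Type) (a : label -> V -> V).

Definition glue_class (v : V) (x : plane) : set (V * plane) :=
  [set wy | thick wy.2 /\ glue_rel a v x wy.1 wy.2].

Definition glue_space : Type :=
  {C : set (V * plane) | exists v x, thick x /\ C = glue_class v x}.

Lemma thick_origin : thick 0.
Proof. by move=> j; have := @height_origin R K j; lra. Qed.

(** Off the thick piece the value is the class of the origin of the same copy; this default lets
    [bond_pos] hold for every [x]. *)
Definition glue_pt (v : V) (x : plane) : glue_space :=
  match pselect (thick x) with
  | left tx => exist _ (glue_class v x) (ex_intro _ v (ex_intro _ x (conj tx erefl)))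
  | right _ => exist _ (glue_class v 0) (ex_intro _ v (ex_intro _ 0 (conj thick_origin erefl)))
  end.

Lemma glue_ptE v x : thick x -> sval (glue_pt v x) = glue_class v x.
Proof. by rewrite /glue_pt; case: pselect. Qed.

HB.instance Definition _ := gen_eqMixin glue_space.
HB.instance Definition _ := gen_choiceMixin glue_space.

Definition glue_open (A : set glue_space) := forall v, open (thick `&` glue_pt v @^-1` A).

Let glue_openT : glue_open setT.
Proof. by move=> v; rewrite preimage_setT setIT; exact: thick_piece_open. Qed.

Let glue_openI (A B : set glue_space) : glue_open A -> glue_open B -> glue_open (A `&` B).
Proof.
by move=> oA oB v; rewrite preimage_setI setIIr; exact: openI.
Qed.

Let glue_openU (I : Type) (F : I -> set glue_space) :
  (forall i, glue_open (F i)) -> glue_open (\bigcup_i F i).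
Proof.
by move=> oF v; rewrite preimage_bigcup setI_bigcupr; apply: bigcup_open => i _; exact: oF.
Qed.

HB.instance Definition _ :=
  isOpenTopological.Build glue_space glue_openT glue_openI glue_openU.

Hypothesis aK : forall j, involutive (a j).

Lemma glue_rel_sym v x w y : glue_rel a v x w y -> glue_rel a w y v x.
Proof.
case=> [[-> ->]|[j [cx -> ->]]]; first by left.
by have [cy _ fx] := collar_flip cx; right; exists j; rewrite fx aK.
Qed.

(** A flipped point stays in its collar, so a second flip carries the same label and undoes the
    first. *)
Lemma glue_rel_trans w y v x u z :
  glue_rel a v x w y -> glue_rel a w y u z -> glue_rel a v x u z.
Proof.
case=> [[-> ->]//|[j [cx yE wE]]] [[<- <-]|[i [cy zE uE]]].
  by right; exists j.
have [cy' _ fx] := collar_flip cx; left; rewrite uE zE wE yE.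
by rewrite yE in cy; rewrite (collar_uniq cy cy') fx aK.
Qed.

Lemma glue_space_glued : glued setT a glue_pt.
Proof.
split.
- move=> p; have [v [x [tx pE]]] := svalP p.
  have sv q r : sval q = sval r -> q = r :> glue_space by exact: eq_sig_hprop.
  have [px|[j [cx py]]] := thick_flip tx.
    by exists v, x; split=> //; apply: sv; rewrite glue_ptE.
  exists (a j v), (flip j x); split=> //.
  apply: sv; rewrite pE glue_ptE; last exact: piece_thick.
  have r : glue_rel a v x (a j v) (flip j x) by right; exists j.
  apply/seteqP; split=> -[w z] [/= tz h]; split=> //=.
    exact: glue_rel_trans (glue_rel_sym r) h.
  exact: glue_rel_trans r h.
- move=> v x w y _ _ tx ty; split=> [e|r].
    have : glue_class v x (w, y).
      by rewrite -glue_ptE// e glue_ptE//; split=> //; left.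
    by case.
  apply: eq_sig_hprop => //; rewrite !glue_ptE//.
  apply/seteqP; split=> -[u z] [/= tz h]; split=> //=.
    exact: glue_rel_trans (glue_rel_sym r) h.
  exact: glue_rel_trans r h.
- by move=> A; have -> : open A = glue_open A by []; split=> [oA v _|oA v]; exact: oA.
Qed.

End glue_space.
End glued.

(** * The solenoid *)

Lemma cantor_nbhs (c : cantor_space) S : nbhs c S ->
  exists m, forall c' : cantor_space, prefix c' m = prefix c m -> S c'.
Proof.
pose F : set_system cantor_space :=
  [set A | exists m, forall c' : cantor_space, prefix c' m = prefix c m -> A c'].
have prefix_le (c' : cantor_space) m m' : (m <= m')%N ->
    prefix c' m' = prefix c m' -> prefix c' m = prefix c m.
  by move=> mm /eq_prefix h; apply/eq_prefix => i im; apply: h; exact: leq_trans mm.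
have FF : Filter F.
  split; first by exists 0.
  - move=> A B [m mA] [m' mB]; exists (maxn m m') => c' h; split.
      by apply: mA; apply: prefix_le h; exact: leq_maxl.
    by apply: mB; apply: prefix_le h; exact: leq_maxr.
  - by move=> A B AB [m mA]; exists m => c' /mA/AB.
have Fc : F --> c.
  apply/cvg_sup => i A [B [[W oW WB] Bc BA]]; exists i.+1 => c' /eq_prefix h.
  by apply: BA; rewrite -WB /= h//; move: Bc; rewrite -WB.
exact: Fc.
Qed.

Lemma prefix_nbhs (c : cantor_space) m : nbhs c [set c' | prefix c' m = prefix c m].
Proof.
elim: m => [|m IH]; first by apply: filterS filterT => c' _.
have : nbhs c [set c' : cantor_space | c' m = c m].
  have := @proj_continuous nat (fun=> bool) m c [set x | x = c m].
  by apply; apply: open_nbhs_nbhs; split=> //; exact: discrete_open.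
by apply: filterS2 IH => c' /= -> ->.
Qed.

Section inverse_limit.
Variables (X : nat -> topologicalType) (g : forall i, X i.+1 -> X i).
Hypothesis gc : forall i, continuous (@g i).
Local Notation threads := [set x : prod_topology X | forall i, @g i (x i.+1) = x i].

(** Conditions on finitely many coordinates can all be pulled back along the bonding maps to the
    largest index. *)
Lemma limit_nbhs (p : set_type threads) S : nbhs p S ->
  exists m (A : set (X m)), [/\ open A, A (val p m) &
    forall q : set_type threads, A (val q m) -> S q].
Proof.
pose F : set_system (prod_topology X) := [set B | exists m (A : set (X m)),
  [/\ open A, A (val p m) & forall q : set_type threads, A (val q m) -> B (val q)]].
have up m m' (A : set (X m)) : (m <= m')%N -> open A -> A (val p m) ->
    exists A' : set (X m'), [/\ open A', A' (val p m') &
      forall q : set_type threads, A' (val q m') -> A (val q m)].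
  elim: m' => [|m' IH]; first by rewrite leqn0 => /eqP m0; subst m; exists A.
  rewrite leq_eqVlt => /orP[/eqP m0|]; first by subst m; exists A.
  move=> /IH h oA Ap; have [A' [oA' A'p A'A]] := h oA Ap.
  have thr (q : set_type threads) : @g m' (val q m'.+1) = val q m' by have := set_valP q; exact.
  exists (@g m' @^-1` A'); split; last by move=> q /=; rewrite thr; exact: A'A.
    by have /continuousP := @gc m'; apply.
  by rewrite /= thr.
have FF : Filter F.
  split; first by exists 0, setT; split=> //; exact: openT.
  - move=> A B [m [A' [oA A'p mA]]] [m' [B' [oB B'p mB]]].
    have [A2 [oA2 A2p A2A]] := up m (maxn m m') A' (leq_maxl _ _) oA A'p.
    have [B2 [oB2 B2p B2B]] := up m' (maxn m m') B' (leq_maxr _ _) oB B'p.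
    exists (maxn m m'), (A2 `&` B2); split; [exact: openI|by []|].
    by move=> q [/A2A/mA ? /B2B/mB].
  - by move=> A B AB [m [A' [oA A'p mA]]]; exists m, A'; split=> // q /mA/AB.
have Fp : F --> (val p : prod_topology X).
  apply/cvg_sup => i A [B [[W oW WB] Bc BA]]; exists i, W; split=> //.
    by move: Bc; rewrite -WB.
  by move=> q Wq; apply: BA; rewrite -WB.
move=> [B [[W oW WB] Bp BS]].
have : nbhs (val p : prod_topology X) W.
  by apply: open_nbhs_nbhs; split=> //; move: Bp; rewrite -WB.
move=> /Fp[m [A [oA Ap AW]]]; exists m, A; split=> // q /AW Wq.
by apply: BS; rewrite -WB.
Qed.

Lemma limit_proj_continuous m : continuous (fun p : set_type threads => val p m).
Proof.
move=> p; apply: (@continuous_comp _ _ _ (fun p : set_type threads => val p)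
  (fun x : prod_topology X => x m)).
  exact: initial_continuous.
exact: proj_continuous.
Qed.

End inverse_limit.

(** * The tower of double coverings and its limit *)

Section solenoid.
Variables (R : realType) (K : nat).
Local Notation label := 'I_K.+3.
Local Notation plane := 'rV[R]_2.
Local Notation thick := (@thick_piece R K).
Local Notation piece := (@piece R K).

Definition level (m : nat) : topologicalType := @glue_space R K (word m) (@act K m).
Definition pos m : word m -> plane -> level m := @glue_pt R K (word m) (@act K m).

Lemma level_glued m : glued setT (@act K m) (@pos m).
Proof. exact: (glue_space_glued R (@actK K m)). Qed.

Lemma bond_ex m : exists g : level m.+1 -> level m,
  forall (w : word m.+1) x, setT w -> thick x -> g (pos w x) = pos (w.1 : word m) x.
Proof.
apply: (glued_map (level_glued m.+1) (level_glued m)) => // j v _.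
exact: act_fst.
Qed.

Definition bond m : level m.+1 -> level m := projT1 (cid (bond_ex m)).

Lemma bondE m (w : word m.+1) x : thick x -> bond (pos w x) = pos (w.1 : word m) x.
Proof. by move=> tx; exact: (projT2 (cid (bond_ex m))). Qed.

Lemma bondE' m (w : word m.+1) x : setT w -> thick x -> bond (pos w x) = pos (w.1 : word m) x.
Proof. by move=> _; exact: bondE. Qed.

Lemma bond_covering m : covering_map (@bond m).
Proof.
apply: (glued_map_covering (f := fun w : word m.+1 => (w.1 : word m)) _ _ _ _
  (level_glued m.+1) (level_glued m)) => //.
- exact: actK.
- exact: actK.
- by move=> j v _; exact: act_fst.
- exact: bondE'.
- by move=> w _; exists (w, true).
Qed.

Lemma bond_continuous m : continuous (@bond m).
Proof. by case: (bond_covering m). Qed.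

Lemma bond_fibre m (w : word m) x (p : level m.+1) : thick x -> bond p = pos w x ->
  exists w' : word m.+1, w'.1 = w /\ p = pos w' x.
Proof.
move=> tx e; have fa (j : label) (v : word m.+1) : setT v -> (act j v).1 = act j v.1.
  by move=> _; exact: act_fst.
have [//|//|w' [_ <- ->]] := glued_map_fibre _ (level_glued m.+1) (level_glued m) _ fa
  (@bondE' m) (I : setT w) tx e.
by exists w'.
Qed.

Lemma pos_inj m (w w' : word m) x : thick x -> pos w x = pos w' x -> w = w'.
Proof.
move=> tx e; have [[]//|[j [/flip_far + xE _]]] :=
  (glued_eq (level_glued m) (I : setT w) (I : setT w') tx tx).1 e.
by rewrite -xE subrr normr0 lern0.
Qed.

Lemma bond_index m : covering_index (@bond m) 2.
Proof.
move=> q; have [w [x [_ px ->]]] := glued_rep (level_glued m) q.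
have tx := piece_thick px.
have -> : @bond m @^-1` [set pos w x] = [set pos ((w, true) : word m.+1) x; pos ((w, false) : word m.+1) x].
  apply/seteqP; split=> [p /= /(bond_fibre tx)[[w' y] [/= <- ->]]|p [] ->].
  - by case: y; [left|right].
  - by rewrite /= bondE.
  - by rewrite /= bondE.
have ne : pos ((w, false) : word m.+1) x <> pos ((w, true) : word m.+1) x.
  by move=> /(pos_inj tx).
apply/(card_set_bijP (U := nat)).
exists (fun p => if p == pos ((w, true) : word m.+1) x then 0%N else 1%N); split.
- by move=> p _; case: ifP.
- move=> p p'; rewrite !inE => -[->|->] [->|->] //=; rewrite eqxx;
    by case: eqP => // h; exfalso; apply: ne.
- move=> [|[|//]] _; [exists (pos ((w, true) : word m.+1) x)|exists (pos ((w, false) : word m.+1) x)].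
  + by left.
  + by rewrite eqxx.
  + by right.
  + by case: eqP.
Qed.

Lemma level_manifold m : closed_connected_manifold R 2 (level m).
Proof.
have G := level_glued m; have aK := @actK K m.
have rT : setT = range (@id (word m)) by apply/seteqP; split=> w // _; exists w.
split; split.
- exact: (glued_hausdorff aK _ G).
- exact: (glued_second_countable aK _ G rT).
- exact: (glued_locally_euclidean aK _ G).
- exact: (glued_compact G rT).
- apply: (glued_connected aK _ G (v0 := prefix xpredT m)) => // w _.
  exact: chain_word.
- by exists (pos (prefix xpredT m) 0).
Qed.

Definition solenoid : weak_solenoid R :=
  WeakSolenoid level_manifold bond_covering
    (fun m => ex_intro2 _ _ 2%N isT (@bond_index m)).
Local Notation X := (ws_limit solenoid).

Lemma bond_pos m (w : word m.+1) x : bond (pos w x) = pos (w.1 : word m) x.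
Proof.
have [tx|ntx] := pselect (thick x); first exact: bondE.
have e k (u : word k) : pos u x = pos u 0.
  rewrite /pos /glue_pt; case: pselect => // _; case: pselect => [t0|nt0]; last by case: nt0; exact: thick_origin.
  exact: eq_sig_hprop.
by rewrite !e bondE//; exact: thick_origin.
Qed.

Lemma pt_thread (b : cantor_space) x : ws_threads solenoid (fun m => pos (prefix b m) x).
Proof. by move=> m; rewrite /= bond_pos. Qed.

Definition Psi (b : cantor_space) (x : plane) : X := SigSub (mem_set (pt_thread b x)).

Lemma Psi_coord b x m : val (Psi b x) m = pos (prefix b m) x.
Proof. by []. Qed.

Lemma limit_eq (p q : X) : (forall m, val p m = val q m) -> p = q.
Proof. by move=> h; apply: val_inj; apply/functional_extensionality_dep. Qed.

Lemma thread_bond (p : X) m : bond (val p m.+1) = val p m.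
Proof. by have := set_valP p; exact. Qed.

Lemma Psi_thread (p : X) x : thick x -> val p 0%N = pos (tt : word 0) x ->
  exists b, p = Psi b x.
Proof.
move=> tx p0; have ex m : exists w : word m, val p m = pos w x.
  elim: m => [|m [w pw]]; first by exists tt.
  have [w' [_ ->]] : exists w' : word m.+1, w'.1 = w /\ val p m.+1 = pos w' x.
    by apply: bond_fibre => //; rewrite thread_bond.
  by exists w'.
pose w m := projT1 (cid (ex m)); have wP m : val p m = pos (w m) x := projT2 (cid (ex m)).
have [b bE] : exists b, forall m, prefix b m = w m.
  apply: word_of_thread => m; apply: (@pos_inj _ _ _ x tx).
  by rewrite -bond_pos -wP thread_bond wP.
by exists b; apply: limit_eq => m; rewrite Psi_coord bE wP.
Qed.

Lemma Psi_rep (p : X) : exists b x, piece x /\ p = Psi b x.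
Proof.
have [[] [x [_ px pE]]] := glued_rep (level_glued 0) (val p 0%N).
by have [b bE] := Psi_thread (piece_thick px) pE; exists b, x.
Qed.

(** A flip moves points by at least 2, so the positions alone decide between equality and flip,
    uniformly in the level; disjoint collars force the same label at all levels. *)
Lemma Psi_eq b x b' y : thick x -> thick y ->
  Psi b x = Psi b' y <-> glue_rel (@actw K) b x b' y.
Proof.
move=> tx ty; have coord m := glued_eq (level_glued m) (I : setT (prefix b m)) (I : setT (prefix b' m)) tx ty.
split=> [e|r]; last first.
  apply: limit_eq => m; apply/coord; case: r => [[-> ->]|[j [cx yE bE]]]; first by left.
  by right; exists j; rewrite bE prefix_actw.
have r m : glue_rel (@act K m) (prefix b m) x (prefix b' m) y.
  by apply/coord; rewrite -[LHS](Psi_coord b x m) e.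
have [[_ xy]|[j [cx yE _]]] := r 0%N.
  left; split=> //; apply: prefix_ext => m.
  have [[]//|[j [/flip_far + yE _]]] := r m.
  by rewrite -yE xy subrr normr0 lern0.
right; exists j; split=> //; apply: prefix_ext => m; rewrite prefix_actw.
have [[_ xy]|[i [cx' _ ->]]] := r m; last by rewrite (collar_uniq cx' cx).
by have := flip_far cx; rewrite -yE xy subrr normr0 lern0.
Qed.

Lemma Psi_lift (p : X) m (w : word m) z : thick z -> val p m = pos w z ->
  exists b, prefix b m = w /\ p = Psi b z.
Proof.
move=> tz; have [b [y [py ->]]] := Psi_rep p; have ty := piece_thick py.
move=> e.
have [[<- <-]|[j [cy zE wE]]] :=
  (glued_eq (level_glued m) (I : setT (prefix b m)) (I : setT w) ty tz).1 e.
  by exists b.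
exists (actw j b); rewrite prefix_actw wE; split=> //.
by apply/Psi_eq => //; right; exists j.
Qed.

Lemma Psi_continuous b x : thick x ->
  {for (x, b), continuous (fun z : plane * cantor_space => Psi z.2 z.1)}.
Proof.
move=> tx S /(limit_nbhs bond_continuous)[m [A [oA Ax AS]]].
have : nbhs x (pos (prefix b m) @^-1` A).
  by apply: (psi_continuous (level_glued m)) => //; exact: open_nbhs_nbhs.
move=> nx; exists (pos (prefix b m) @^-1` A, [set c | prefix c m = prefix b m]) => /=.
  by split=> //; exact: prefix_nbhs.
by move=> [z c] /= [Az cb]; apply: AS; rewrite Psi_coord cb.
Qed.

Lemma Psi_continuous1 b x : thick x -> {for x, continuous (Psi b)}.
Proof.
move=> tx S nS; have [[A B] /= [nA nB] AB] := @Psi_continuous b x tx S nS.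
by apply: filterS nA => z Az; apply: (AB (z, b)); split=> //; exact: nbhs_singleton.
Qed.

Definition Phi (x : plane) (d : R) (uc : plane * cantor_space) : X :=
  Psi uc.2 (dmap x d uc.1).

Lemma Phi_chart x d : 0 < d -> d <= 1 -> ball x d `<=` thick ->
  foliated_chart (S := solenoid) (Phi x d).
Proof.
move=> d0 d1 bt; have td u : open_disk R 2 u -> thick (dmap x d u).
  by move=> du; apply: bt; exact: dmap_ball.
split.
- apply: continuous_in_subspaceT => -[u c]; rewrite inE => -[/= du _].
  apply: (@continuous_comp _ _ _ (fun z : plane * cantor_space => (dmap x d z.1, z.2))
    (fun z : plane * cantor_space => Psi z.2 z.1)); last exact: (@Psi_continuous c _ (td _ du)).
  move=> S [[A B] /= [nA nB] AB]; exists (dmap x d @^-1` A, B) => /=.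
    by split=> //; exact: (@dmap_continuous R x d u).
  by move=> [v e] /= [Av Be]; exact: (AB (_, _)).
- move=> [u c] [u' c']; rewrite !inE => -[/= du _] [/= du' _].
  move=> /Psi_eq[]; [exact: td|exact: td| |].
    by move=> /= [-> /(dmap_inj d0)->].
  move=> [j /= [/flip_far far e _]]; exfalso; rewrite -e in far.
  have := ball_triangle (ball_sym (dmap_ball x d0 du)) (dmap_ball x d0 du').
  by rewrite -ball_normE /= => h; have := le_lt_trans far h; lra.
(* A neighbourhood of (u, c) contains a disk times a cylinder of some rank m, and by [Psi_lift] such
   a cylinder is what an open set of level m cuts out. *)
- move=> A oA Ad; rewrite openE => _ [[u c] Auc <-].
  have : nbhs (u, c) A by exact: open_nbhs_nbhs.
  move=> [[B C] /= [nB /cantor_nbhs[m mC]] BC].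
  have [du _] := Ad _ Auc.
  pose B' := B° `&` open_disk R 2.
  have oB' : open (dmap x d @` B').
    apply: dmap_open => //; apply: openI; [exact: open_interior|exact: disk_open].
  pose Q := pos (prefix c m) @` (dmap x d @` B').
  have oQ : open Q.
    apply: (psi_open (@actK K m) _ (level_glued m)) => // _ [v [_ dv] <-].
    exact: td.
  have : nbhs (Phi x d (u, c)) [set q : X | Q (val q m)].
    apply: (@limit_proj_continuous _ (@bond) m); apply: open_nbhs_nbhs; split=> //.
    by exists (dmap x d u) => //; exists u.
  apply: filterS => q [_ [v [Bv dv] <-] /esym qE].
  have [c' [c'm ->]] := Psi_lift (td _ dv) qE.
  exists (v, c') => //; apply: BC; split; [exact: interior_subset|exact: mC].
Qed.

End solenoid.

Lemma ball_connected (R : realType) (x : 'rV[R]_2) d : 0 < d -> connected (ball x d).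
Proof.
move=> d0; apply: (@joined_connected R _ _ x) => z bz.
exists (fun t : R => z + t *: (x - z)); split.
- apply: continuous_subspaceT => t.
  exact: (continuousD (@cst_continuous _ _ z t)
    (@scalel_continuous R 'rV[R]_2 (x - z) t)).
- by rewrite scale0r addr0.
- by rewrite scale1r addrC subrK.
- move=> t t01; move: bz; rewrite -ball_normE /= => bz.
  have -> : x - (z + t *: (x - z)) = (1 - t) *: (x - z).
    by rewrite opprD addrA scalerBl scale1r.
  by rewrite normrZ ger0_norm; [apply: le_lt_trans bz; rewrite ler_piMl//; lra|lra].
Qed.

(** Each bit of the transverse coordinate splits the chart into two disjoint open sets, hence is
    constant on a connected set. *)
Lemma chart_connected (R : realType) (S : weak_solenoid R)
    (phi : 'rV[R]_(ws_dim S) * cantor_space -> ws_limit S) (C : set (ws_limit S)) u c :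
  foliated_chart phi -> open_disk R (ws_dim S) u -> connected C ->
  C `<=` phi @` (open_disk R (ws_dim S) `*` setT) -> C (phi (u, c)) ->
  open (open_disk R (ws_dim S)) ->
  C `<=` phi @` (open_disk R (ws_dim S) `*` [set c]).
Proof.
set D := open_disk R (ws_dim S) => -[_ inj op] Du cC CD Cu oD q Cq.
have injD (v v' : 'rV[R]_(ws_dim S)) (d d' : cantor_space) : D v -> D v' ->
    phi (v, d) = phi (v', d') -> d = d'.
  move=> Dv Dv' ee; have i1 : (v, d) \in D `*` [set: cantor_space] by rewrite inE.
  have i2 : (v', d') \in D `*` [set: cantor_space] by rewrite inE.
  by have [] := inj _ _ i1 i2 ee.
have [[u' c'] [/= Du' _] e] := CD _ Cq; rewrite -e in Cq *.
suff -> : c = c' by exists (u', c').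
apply/funext => i.
pose B x := phi @` (D `*` [set c' : cantor_space | c' i = x]).
have oB x : open (B x).
  apply: op; last by move=> [v d] [].
  have -> : D `*` [set c' : cantor_space | c' i = x] =
      (fst @^-1` D) `&` (snd @^-1` [set c' : cantor_space | c' i = x]) by [].
  apply: openI; apply: open_comp => //; try by move=> ? _; exact: cvg_fst.
    by move=> ? _; exact: cvg_snd.
  have -> : [set c' : cantor_space | c' i = x] = proj i @^-1` [set x] by [].
  by apply: open_comp; [move=> ? _; exact: proj_continuous|exact: discrete_open].
have disj x p : B x p -> B (~~ x) p -> False.
  move=> [[v d] [/= Dv dx] <-] [[v' d'] [/= Dv' dx'] ee].
  by move: dx'; rewrite (injD _ _ _ _ Dv' Dv ee) dx; case: (x).
have e1 : C `&` B (c i) = C.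
  apply: cC.
  - by exists (phi (u, c)); split=> //; exists (u, c).
  - by exists (B (c i)).
  exists (~` B (~~ c i)); first exact: open_closedC.
  apply/seteqP; split=> p [Cp]; first by move=> h; split=> // /(disj _ _ h).
  move=> nB; split=> //; have [[v d] [/= Dv _] pE] := CD _ Cp.
  exists (v, d) => //; split=> //=; apply/eqP/negPn/negP => ne; apply: nB.
  by exists (v, d) => //; split=> //=; case: (d i) (c i) ne => -[].
have : B (c i) (phi (u', c')) by move: Cq; rewrite -e1 => -[].
by move=> [[v d] [/= Dv <-]] /(injD _ _ _ _ Dv Du')->.
Qed.

(** * Leaves *)

Section leaf.
Variables (R : realType) (K : nat).
Local Notation label := 'I_K.+3.
Local Notation plane := 'rV[R]_2.
Local Notation thick := (@thick_piece R K).
Local Notation piece := (@piece R K).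
Local Notation S := (solenoid R K).
Local Notation X := (ws_limit S).
Local Notation Psi := (@Psi R K).

(** The plaque may come from any chart. Small balls have connected images inside that chart, hence
    inside one plaque. *)
Lemma plaque_open P (b : cantor_space) : plaque (S := S) P -> open (thick `&` Psi b @^-1` P).
Proof.
move=> [phi [c [ch ->]]]; have [_ inj op] := ch.
set D := open_disk R (ws_dim S) in ch *.
have oD : open D by exact: disk_open.
rewrite openE => x [tx [[u d] [/= Du dc] e]]; rewrite /= in dc; subst d.
have : nbhs x (thick `&` Psi b @^-1` (phi @` (D `*` setT))).
  apply: filterI; first by apply: open_nbhs_nbhs; split=> //; exact: thick_piece_open.
  apply: (@Psi_continuous1 R K b x tx (phi @` (D `*` setT))); apply: open_nbhs_nbhs; split; last first.
    by rewrite -e; exists (u, c).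
  apply: op => //; have -> : D `*` setT = fst @^-1` D :> set (_ * cantor_space).
    by apply/seteqP; split=> // -[v d] [].
  by apply: open_comp => // ? _; exact: cvg_fst.
move=> /nbhs_ballP[r /= r0 br]; apply/nbhs_ballP; exists r => //= z bz.
split; first by have [] := br _ bz.
suff : Psi b @` ball x r `<=` phi @` (D `*` [set c]) by apply; exists z.
apply: (chart_connected (u := u)) => //.
  apply: connected_continuous_connected (ball_connected r0) _.
  apply: continuous_in_subspaceT => w; rewrite inE => /br[tw _].
  exact: Psi_continuous1.
- by move=> _ [w /br[_ h] <-].
- by exists x => //; exact: ballxx.
Qed.

Definition leafset (b : cantor_space) : set X :=
  [set p | exists b' x, [/\ cofinal b b', thick x & p = Psi b' x]].

Lemma leafset_Psi b b' x : cofinal b b' -> thick x -> leafset b (Psi b' x).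
Proof. by move=> bb tx; exists b', x. Qed.

Lemma leafset_self b : leafset b (Psi b 0).
Proof. by apply: leafset_Psi; [exact: cofinal_refl|exact: thick_origin]. Qed.

Definition leafPsi (b : cantor_space) (v : nat -> bool) (x : plane) : leaf_space (leafset b) :=
  insubd (SigSub (mem_set (leafset_self b)) : set_type (leafset b)) (Psi v x).

Lemma leafPsi_val b v x : cofinal b v -> thick x -> set_val (leafPsi b v x) = Psi v x.
Proof.
by move=> bv tx; rewrite /leafPsi set_valE val_insubd mem_set//; exact: leafset_Psi.
Qed.

Lemma leafset_inj b (p q : leaf_space (leafset b)) : set_val p = set_val q -> p = q.
Proof. exact: val_inj. Qed.

Lemma leaf_rep b (p : leaf_space (leafset b)) :
  exists v x, [/\ cofinal b v, piece x & p = leafPsi b v x].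
Proof.
have [v [x [bv tx pE]]] := set_valP p.
have [px|[j [cx py]]] := thick_flip tx.
  by exists v, x; split=> //; apply: leafset_inj; rewrite leafPsi_val.
have ty := piece_thick py; exists (actw j v), (flip j x).
have bj : cofinal b (actw j v) by apply: cofinal_trans bv _; exact: cofinal_actw.
split=> //; apply: leafset_inj; rewrite leafPsi_val//.
by apply: (etrans pE); apply/Psi_eq => //; right; exists j.
Qed.

(** The leaf topology is not too fine by [plaque_open], and not too coarse because the plaques of
    the charts [Phi] are images of arbitrarily small disks. *)
Lemma leaf_glued b : glued (cofinal b) (@actw K) (leafPsi b).
Proof.
split; first exact: leaf_rep.
  move=> v x w y bv bw tx ty; rewrite -Psi_eq//.
  split=> [e|e]; first by rewrite -(leafPsi_val bv tx) e leafPsi_val.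
  by apply: leafset_inj; rewrite !leafPsi_val.
move=> O; split=> [oO v bv|H].
  rewrite openE => x [tx Ox].
  have : nbhs (leafPsi b v x) O by exact: open_nbhs_nbhs.
  move=> [_ [[F FB <-] [B FBB Bx] FO]].
  have [E ED EB] : exists2 E : {fset (set (leaf_space (leafset b)))},
    {subset E <= leaf_plaque (L := leafset b)} & \bigcap_(Q in [set` E]) Q = B := FB _ FBB.
  move: Bx; rewrite -EB => Bx.
  pose f (Q : set (leaf_space (leafset b))) := thick `&` leafPsi b v @^-1` Q.
  have nE : nbhs x (\bigcap_(Q in [set` E]) f Q).
    apply: filter_bigI => Q QE; have := ED _ QE; rewrite inE => -[P [plP PL] QP].
    have : nbhs x (thick `&` Psi v @^-1` P).
      apply: open_nbhs_nbhs; split; first exact: plaque_open.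
      by split=> //=; have := Bx _ QE; rewrite QP /= leafPsi_val.
    apply: filterS => z [tz Pz]; split=> //.
    by rewrite QP /= leafPsi_val.
  have tn : nbhs x thick by apply: open_nbhs_nbhs; split=> //; exact: thick_piece_open.
  apply: filterS (filterI tn nE) => z [tz h]; split=> //.
  have {}h : (\bigcap_(Q in [set` E]) Q) (leafPsi b v z) by move=> Q QE; have [] := h _ QE.
  by apply: FO; exists B => //; rewrite -EB; exact: h.
rewrite openE => p Op; have [v [x [bv px pE]]] := leaf_rep p.
have tx := piece_thick px; have oT := H v bv.
have : nbhs x (thick `&` leafPsi b v @^-1` O).
  by apply: open_nbhs_nbhs; split=> //; split=> //=; rewrite -pE.
move=> /nbhs_ballP[r /= r0 br].
set d := Num.min r 1; have d0 : 0 < d by rewrite lt_min r0 ltr01.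
have d1 : d <= 1 by rewrite ge_min lexx orbT.
have bd : ball x d `<=` thick `&` leafPsi b v @^-1` O.
  by move=> z bz; apply: br; apply: le_ball bz; rewrite ge_min lexx.
have bt : ball x d `<=` thick by move=> z /bd[].
pose P := Phi K x d @` (open_disk R 2 `*` [set v : cantor_space]).
have PL : P `<=` leafset b.
  move=> _ [[u c] [/= du ->] <-]; apply: leafset_Psi => //.
  by apply: bt; exact: dmap_ball.
have subQ : leaf_plaque (set_val @^-1` P : set (leaf_space (leafset b))).
  exists P => //; split=> //; exists (Phi K x d), v; split=> //.
  exact: Phi_chart.
have oQ : open (set_val @^-1` P : set (leaf_space (leafset b))).
  exists [set set_val @^-1` P]; last by rewrite bigcup_set1.
  move=> _ ->; exact: finI_from1.
have : nbhs p (set_val @^-1` P : set (leaf_space (leafset b))).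
  apply: open_nbhs_nbhs; split=> //; rewrite pE /= leafPsi_val//.
  by exists (0, v); [split=> //; exact: disk0|rewrite /Phi /= dmap0].
apply: filterS => q [[u c] [/= du cv] qE]; rewrite /= in cv; subst c.
have bu := dmap_ball x d0 du; have [tu Ou] := bd _ bu.
suff -> : q = leafPsi b v (dmap x d u) by [].
by apply: leafset_inj; rewrite leafPsi_val.
Qed.

End leaf.

(** * Leaves as cofinality classes *)

Section leaves.
Variables (R : realType) (K : nat).
Local Notation label := 'I_K.+3.
Local Notation plane := 'rV[R]_2.
Local Notation thick := (@thick_piece R K).
Local Notation piece := (@piece R K).
Local Notation S := (solenoid R K).
Local Notation X := (ws_limit S).
Local Notation Psi := (@Psi R K).
Local Notation leafset := (@leafset R K).

Lemma chain_cofinal b v : cofinal b v -> chain (@actw K) set0 v b.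
Proof.
move=> [m mP]; have h := @chain_splice K m (prefix v m) (prefix b m) b set0 (fun _ => id).
rewrite -(splice_unique (b := v) (erefl (prefix v m)) mP) in h.
by rewrite -(splice_unique (b := b) (erefl (prefix b m)) (fun i _ => erefl)) in h.
Qed.

Lemma leafset_cofinal b c z : thick z -> leafset b (Psi c z) <-> cofinal b c.
Proof.
move=> tz; split=> [[b' [x [bb tx /Psi_eq e]]]|bc]; last exact: leafset_Psi.
have [[-> //]|[j [_ _ b'E]]] := e tz tx.
by apply: (cofinal_trans bb); rewrite b'E; exact/cofinal_sym/cofinal_actw.
Qed.

Lemma cofinal_leafset b b' : cofinal b b' -> leafset b = leafset b'.
Proof.
move=> bb; apply/seteqP; split=> p [c [x [bc tx ->]]]; apply: leafset_Psi => //.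
  exact: cofinal_trans (cofinal_sym bb) bc.
exact: cofinal_trans bb bc.
Qed.

Lemma leafset_eq b b' : leafset b = leafset b' -> cofinal b b'.
Proof.
move=> e; apply/(@leafset_cofinal _ _ 0); first exact: thick_origin.
by rewrite e; exact: leafset_self.
Qed.

Lemma leaf_val_continuous b : continuous (set_val : leaf_space (leafset b) -> X).
Proof.
apply/continuousP => A oA; have [_ _ op] := leaf_glued R K b; apply/op => v bv.
have -> : thick `&` leafPsi K b v @^-1` (set_val @^-1` A) = thick `&` Psi v @^-1` A.
  by apply/seteqP; split=> x [tx]; rewrite /= leafPsi_val.
rewrite openE => x [tx Ax]; apply: filterI.
  by apply: open_nbhs_nbhs; split=> //; exact: thick_piece_open.
by apply: (@Psi_continuous1 R K v x tx A); apply: open_nbhs_nbhs.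
Qed.

Lemma leafset_joined b p q : leafset b p -> leafset b q -> path_joined R p q.
Proof.
move=> bp bq; pose P : leaf_space (leafset b) := SigSub (mem_set bp).
pose Q : leaf_space (leafset b) := SigSub (mem_set bq).
have J := glued_joined (@actwK K) (fun j v bv => cofinal_trans bv (cofinal_actw j v))
  (leaf_glued R K b) (cofinal_refl b) (@chain_cofinal b).
have PQ : joined R setT P Q by apply: joined_trans (J P) (joined_sym (J Q)).
apply: (joined_path_joined (A := setT)).
have h := joined_image (B := setT) (fun a _ => @leaf_val_continuous b a) (fun _ _ => I) PQ.
exact: h.
Qed.

(** Membership in the leaf is locally constant along a path: a short stretch stays in one plaque of
    a chart [Phi], where the sequence is fixed. *)
Lemma path_leafset b x q : thick x -> path_joined R (Psi b x) q -> leafset b q.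
Proof.
move=> tx [g [gc g0 <-]].
have loc (t : R) : `[0, 1]%classic t -> exists2 r : R, 0 < r &
    forall s : R, ball t r s -> `[0, 1]%classic s -> leafset b (g s) <-> leafset b (g t).
  move=> t01; have [c [z [pz gt]]] := Psi_rep (g t).
  have tz := piece_thick pz; have [d [d0 d1 bt]] := good_radius tz.
  have ch := Phi_chart d0 d1 bt; have [_ _ op] := ch.
  pose D := open_disk R 2; have oD : open D by exact: disk_open.
  have oW : open (Phi K z d @` (D `*` setT)).
    apply: op => //; have -> : D `*` setT = fst @^-1` D :> set (_ * cantor_space).
      by apply/seteqP; split=> // -[v e] [].
    by apply: open_comp => // ? _; exact: cvg_fst.
  have gtW : Phi K z d (0, c) = g t by rewrite /Phi /= dmap0.
  have /subspace_continuousP/(_ _ t01) gct := gc.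
  have : nbhs (g t) (Phi K z d @` (D `*` setT)).
    by apply: open_nbhs_nbhs; split=> //; exists (0, c) => //; split=> //; exact: disk0.
  move=> /gct; rewrite /nbhs /= /within /= => /nbhs_ballP[r /= r0 br].
  exists r => // s bs s01.
  have itv : connected (ball t r `&` `[0, 1]).
    apply/connected_intervalP => u v [bu u01] [bv v01] w /andP[uw wv].
    move: bu bv u01 v01; rewrite -ball_normE /= !in_itv /= !ltr_norml; lra.
  have cC : connected (g @` (ball t r `&` `[0, 1])).
    apply: connected_continuous_connected itv _.
    by apply: continuous_subspaceW gc => u [].
  have CW : g @` (ball t r `&` `[0, 1]) `<=` Phi K z d @` (D `*` setT).
    by move=> _ [u [bu u01] <-]; exact: br.
  have Ct : (g @` (ball t r `&` `[0, 1])) (Phi K z d (0, c)).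
    by rewrite gtW; exists t => //; split=> //; exact: ballxx.
  have [|[u e] [/= Du ->] <-] := chart_connected ch (disk0 R) cC CW Ct oD (t := g s).
    by exists s.
  rewrite -gtW /Phi /= !leafset_cofinal//.
    by rewrite dmap0.
  by apply: bt; exact: dmap_ball.
pose B := [set s | `[0, 1]%classic s /\ leafset b (g s)].
have i01 : connected (`[0, 1]%classic : set R) by exact: segment_connected.
have BE : B = `[0, 1]%classic.
  apply: i01.
  - exists 0; split; first by rewrite /= in_itv /= lexx ler01.
    by rewrite g0; apply: leafset_Psi => //; exact: cofinal_refl.
  - exists [set s | `[0, 1]%classic s -> leafset b (g s)]°; first exact: open_interior.
    apply/seteqP; split=> s [s01].
      move=> bs; split=> //; have [r r0 rP] := loc _ s01.
      by apply/nbhs_ballP; exists r => // u bu u01; apply/(rP u).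
    by move=> /interior_subset h; split=> //; exact: h.
  - exists (~` [set s | `[0, 1]%classic s -> ~ leafset b (g s)]°).
      by apply: open_closedC; exact: open_interior.
    apply/seteqP; split=> s [s01].
      by move=> bs; split=> // /interior_subset/(_ s01).
    move=> ns; split=> //; apply: contrapT => nb; apply: ns.
    have [r r0 rP] := loc _ s01.
    by apply/nbhs_ballP; exists r => // u bu u01 /(rP u bu u01).
have : `[0, 1]%classic (1 : R) by rewrite /= in_itv /= lexx ler01.
by rewrite -BE => -[].
Qed.

Lemma path_component_leafset b x : thick x -> path_component R (Psi b x) = leafset b.
Proof.
move=> tx; apply/seteqP; split=> q; first exact: path_leafset.
by apply: leafset_joined; apply: leafset_Psi => //; exact: cofinal_refl.
Qed.

Lemma leafP (L : set X) : leaf L <-> exists b, L = leafset b.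
Proof.
split=> [[p ->]|[b ->]].
  have [b [x [px ->]]] := Psi_rep p; exists b.
  by apply: path_component_leafset; exact: piece_thick.
exists (Psi b 0); rewrite path_component_leafset//; exact: thick_origin.
Qed.

End leaves.

(** * Ends of the leaves *)

Section leaf_ends.
Variables (R : realType) (K : nat).
Local Notation label := 'I_K.+3.
Local Notation thick := (@thick_piece R K).
Local Notation piece := (@piece R K).
Local Notation leafset := (@leafset R K).
Variable b : nat -> bool.
Local Notation T := (leaf_space (leafset b)).
Local Notation psi := (@leafPsi R K b).
Let G := leaf_glued R K b.
Let aK := @actwK K.
Let aD j v (bv : cofinal b v) := cofinal_trans bv (@cofinal_actw K j v).

Definition core (m : nat) : set T := copies K psi (stage b m).
Definition sector (m : nat) (c : label) : set T :=
  part K (cofinal b) psi (stage b m) (heading b m) c.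

Lemma stage_cofinal m : stage b m `<=` cofinal b.
Proof. by move=> v h; exists m. Qed.

Lemma core_compact m : compact (core m).
Proof.
apply: (copies_compact G (f := fun w : word m => splice w b)); first exact: stage_cofinal.
apply/seteqP; split=> [v h|_ [w _ <-] i mi]; last exact: splice_ge.
by exists (prefix v m) => //; apply/esym/splice_unique.
Qed.

Lemma core_le m m' : (m <= m')%N -> core m `<=` core m'.
Proof. by move=> mm p [v /(stage_le mm) h pv]; exists v. Qed.

Lemma core_absorb A : compact A -> exists m, A `<=` core m.
Proof.
move=> cA; apply: (absorb_copies aK aD G _ _ _ cA).
- exact: stage_cofinal.
- by move=> m; exact: stage_le.
- by move=> v [m h]; exists m.
Qed.

Lemma sector_ex m p : ~ core m p -> exists c, sector m c p.
Proof. by apply: (part_ex G) => v bv nv; exact: heading_ex. Qed.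

Lemma sector_uniq m c c' p : sector m c p -> sector m c' p -> c = c'.
Proof.
apply: (part_uniq G) => [v d d'|v d|v j d _]; first exact: heading_uniq.
  exact: heading_notin.
exact: heading_act.
Qed.

Lemma sector_component m c p : sector m c p ->
  ~ core m p /\ connected_component (~` core m) p = sector m c.
Proof.
move=> cp; split; first by case: cp.
apply: (part_component aK aD G (@stage_cofinal m) (n := across b m) _ _ _ _ _ _ cp).
- apply: compact_closed; first exact: (glued_hausdorff aK aD G).
  exact: core_compact.
- by move=> v d d'; exact: heading_uniq.
- by move=> v bv nv; exact: heading_ex.
- by move=> v d; exact: heading_notin.
- by move=> v j d _; exact: heading_act.
- by move=> v d _; exact: chain_heading.
Qed.

Lemma sector_dir m l c : sector (m + l) c `<=` sector m (dir b m l c).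
Proof.
move=> p [np [v [x [bv tx pE hv]]]]; split.
  by move=> mp; apply: np; apply: core_le mp; exact: leq_addr.
by exists v, x; split=> //; exact: heading_dir.
Qed.

Lemma sector_nonempty m l : sector m (dir b m l ord0) !=set0.
Proof.
have h := @across_heading K b m l; set v := across b (m + l) ord0 in h.
have bv : cofinal b v.
  by have [k [st _] _] := h; exists (m + k).+1.
exists (psi v 0); split; last first.
  by exists v, 0; split=> //; exact: thick_origin.
apply: (notin_copies aK G (@stage_cofinal m)) => //.
- exact: heading_notin h.
- by move=> j; exact/ltW/height_origin.
- by move=> j _; exact: height_origin.
Qed.

Lemma sector_dir_ex m c p : sector m c p -> exists l, c = dir b m l ord0.
Proof. by move=> [_ [v [x [_ _ _ [l _ ->]]]]]; exists l. Qed.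

(** [x i] numbers the directions that occur at rank [l i], in such a way that the transition maps
    [dir] preserve numbers. *)
Lemma leaf_ends_card (N : nat) (l : nat -> nat) (x : nat -> nat -> label) :
  (forall i, (i <= l i)%N) -> (forall i, (l i <= l i.+1)%N) ->
  (forall i k, exists2 c, (c < N)%N & dir b (l i) k ord0 = x i c) ->
  (forall i c, (c < N)%N -> exists k, x i c = dir b (l i) k ord0) ->
  (forall i c, (c < N)%N -> dir b (l i) (l i.+1 - l i) (x i.+1 c) = x i c) ->
  (forall i c c', (c < N)%N -> (c' < N)%N -> x i c = x i c' -> c = c') ->
  (ends T #= `I_N)%card.
Proof.
move=> il ll xex xin xdir xinj.
apply: (@ends_card T (fun i => core (l i)) _ _ _ N
  (fun i c => [set p | (c < N)%N /\ sector (l i) (x i c) p])).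
- by move=> i; exact: core_compact.
- by move=> i; exact/core_le/ll.
- move=> A /core_absorb[m Am]; exists m; apply: subset_trans Am _; exact/core_le/il.
- move=> i p /sector_ex[c cp]; have [k ck] := sector_dir_ex cp.
  have [d dN e] := xex i k; exists d => //; split=> //.
  by rewrite -e -ck.
- move=> i c cN; have [k ->] := xin i c cN.
  by have [p pP] := sector_nonempty (l i) k; exists p.
- move=> i c p [cN cp]; have [np ->] := sector_component cp; split=> //.
  by apply/seteqP; split=> q // [].
- move=> i c cN p [_ cp]; split=> //; rewrite -xdir//; apply: sector_dir.
  by rewrite subnKC.
- move=> i c c' p [cN cp] [c'N c'p]; apply: (xinj i) => //.
  exact: sector_uniq cp c'p.
Qed.

Lemma leaf_ends_one : (forall m, exists2 i, (m <= i)%N & b i && b i.+1) ->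
  (ends T #= `I_1)%card.
Proof.
move=> inf.
have inf' m : exists i, (m <= i)%N /\ b i && b i.+1 by have [i h1 h2] := inf m; exists i.
have [f fP] := choice inf'.
pose l i := iter i (fun m => f m.+1) (f 0%N).
have lP i : b (l i) /\ b (l i).+1 by case: i => [|i]; apply/andP; exact: (fP _).2.
have ll i : (l i < l i.+1)%N by exact: (fP _).1.
apply: (@leaf_ends_card 1 l (fun _ _ => ord0)) => //.
- by elim=> // i IH; exact: leq_ltn_trans IH (ll i).
- by move=> i; exact/ltnW/ll.
- move=> i k; exists 0%N => //; have [b1 b2] := lP i.
  by apply: (heading_11 b1 b2); exact: across_heading.
- by move=> i c _; exists 0%N.
- move=> i c _; have [b1 b2] := lP i.
  by apply: (heading_11 b1 b2); apply: heading_dir; exact: (@across_heading K b _ 0).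
- by move=> i [|c] [|c'].
Qed.

Lemma leaf_ends_zero : (exists m, forall i, (m <= i)%N -> b i = false) ->
  (ends T #= `I_K.+3)%card.
Proof.
move=> [m mP]; have dirE i k (c : label) : (m <= i)%N -> dir b i k c = ((c + k) %% K.+3)%N :> nat.
  by move=> mi; apply: dir_false => j _; apply: mP; lia.
have inordE c : (c < K.+3)%N -> (inord c : label) = c :> nat by move=> cK; rewrite inordK.
(* Ranks are spaced by the order K+3 of the cyclic shift, so the transition maps are the
   identity. *)
apply: (@leaf_ends_card K.+3 (fun i => m + i * K.+3)%N (fun _ c => inord c : label)).
- by move=> i; lia.
- by move=> i; lia.
- move=> i k; exists (k %% K.+3)%N; first by rewrite ltn_mod.
  by apply: val_inj; rewrite /= dirE ?leq_addr// inordE ?ltn_mod.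
- move=> i c cK; exists c; apply: val_inj.
  by rewrite /= dirE ?leq_addr// inordE// modn_small.
- move=> i c cK; apply: val_inj; rewrite /= dirE ?leq_addr//.
  have -> : (m + i.+1 * K.+3 - (m + i * K.+3) = K.+3)%N by lia.
  by rewrite inordE// modnDr modn_small.
- by move=> i c c' cK c'K /(congr1 (@nat_of_ord _)); rewrite !inordE.
Qed.

(** At a rank where [b] is 1 only the directions 0 and 1 occur; membership in sector 0 tells them
    apart. *)
Lemma leaf_ends_not (N : nat) : (2 < N)%N -> (forall m, exists2 i, (m <= i)%N & b i) ->
  ~ (ends T #= `I_N)%card.
Proof.
move=> N2 inf; apply: (ends_not_card core_compact _ core_absorb N2).
  by move=> m; exact/core_le/leqnSn.
move=> m; have [i mi bi] := inf m; exists i => //; exists (fun p => `[< sector i ord0 p >]).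
have small c p : sector i c p -> (c < 2)%N.
  by move=> /sector_dir_ex[k ->]; apply: (heading_1 bi); exact: across_heading.
move=> p q np nq; have [c cp] := sector_ex np; have [d dq] := sector_ex nq.
move=> e; suff cd : c = d.
  rewrite cd in cp; rewrite (sector_component cp).2; exact: dq.
apply: val_inj => /=.
have h c' r : sector i c' r -> (c' == 0%N :> nat) = `[< sector i ord0 r >].
  move=> c'r; apply/eqP/asboolP => [c0|/(sector_uniq c'r)-> //].
  by rewrite (_ : ord0 = c')//; exact/val_inj.
have := small _ _ cp; have := small _ _ dq.
have := h _ _ cp; rewrite e -(h _ _ dq).
by case: (c : nat) (d : nat) => [|[|?]] [|[|?]].
Qed.

(* Over a block 1 0^(M-1), where M = K.+3, the directions 0 and 1 are swapped,
   and over a block 0^M all the directions are fixed. *)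
Lemma dir_block m (c : label) : (c < 2)%N ->
  (forall i, (0 < i < K.+3)%N -> b (m + i) = false) ->
  dir b m K.+3 c = (if b m then 1 - c else c)%N :> nat.
Proof.
move=> c2 bF; have e : dir b m.+1 K.+2 c = ((c + K.+2) %% K.+3)%N :> nat.
  by apply: dir_false => i iK; rewrite addSnnS; apply: bF; lia.
change (dir b m K.+3 c) with (delta (b m) (dir b m.+1 K.+2 c)).
case: (b m); last first.
  rewrite delta_falseE e -[X in (X %% _)%N]addn1 modnDml -addnA addn1 modnDr.
  by rewrite modn_small.
rewrite delta_true -val_eqE /= e; case: (c : nat) c2 => [|[|//]] _.
  by rewrite add0n modn_small// eqxx inordK.
by rewrite add1n modnn.
Qed.

Lemma leaf_ends_two :
  (forall i, ~~ (K.+3 %| i)%N -> b i = false) ->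
  (forall q, ~~ odd q -> b (q * K.+3)%N) ->
  (ends T #= `I_2)%card.
Proof.
move=> bF bT; set M := K.+3.
have block q i : (0 < i < M)%N -> b (q * M + i)%N = false.
  move=> /andP[i0 iM]; apply: bF; rewrite dvdn_addr ?dvdn_mull//.
  by rewrite gtnNdvd.
(* Ranks advance by two blocks: the first always carries a 1, so that both directions occur, and the
   second carries one when [s i] holds. *)
pose l i := (i.*2 * M)%N.
have lE i : (l i.+1 - l i = M + M)%N by rewrite /l; lia.
have bl i : b (l i) by apply: bT; rewrite odd_double.
pose s i := b ((i.*2).+1 * M)%N.
have two i (c : label) : (c < 2)%N ->
    dir b (l i) (M + M) c = (if ~~ s i then 1 - c else c)%N :> nat.
  move=> c2; have e2 : dir b (l i + M) M c = (if s i then 1 - c else c)%N :> nat.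
    have -> : (l i + M = (i.*2).+1 * M)%N by rewrite /l; lia.
    exact: dir_block c2 (block (i.*2).+1).
  have l2 : (dir b (l i + M) M c < 2)%N by rewrite e2; case: (s i) => //; lia.
  rewrite dirD (dir_block l2 (block i.*2)) (bl i) e2; case: (s i) => //=.
  by rewrite subKn.
(* The numbering is pushed forward although transition maps go backward; this works since a double
   block acts on the labels 0 and 1 as an involution. *)
pose x i c := iteri i (fun k d => dir b (l k) (M + M) d) (inord c : label).
have x2 i c : (c < 2)%N -> (x i c < 2)%N.
  move=> c2; elim: i => [|i IH]; first by rewrite /x /= inordK// (ltn_trans c2).
  by rewrite /x /= -/(x i c) two//; case: (s i) => /=; lia.
have xinj i c c' : (c < 2)%N -> (c' < 2)%N -> x i c = x i c' -> c = c'.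
  move=> c2 c'2; elim: i => [|i IH].
    by rewrite /x /= => /(congr1 (@nat_of_ord _)); rewrite !inordK// (ltn_trans _ (_ : 2 < K.+3)%N).
  move=> /(congr1 (@nat_of_ord _)); rewrite /x /= -/(x i c) -/(x i c') !two ?x2//.
  move=> e; apply: IH; apply: val_inj => /=; move: (x2 i c c2) (x2 i c' c'2) e.
  by case: (s i) => /=; lia.
have heads i k : (dir b (l i) k (ord0 : label) < 2)%N.
  by apply: (heading_1 (bl i)); exact: across_heading.
have d0 i : dir b (l i) 0 (ord0 : label) = 0%N :> nat by [].
have d1 i : dir b (l i) M (ord0 : label) = 1%N :> nat.
  have h := @dir_block (i.*2 * M)%N (ord0 : label) isT (block i.*2).
  rewrite (bl i) in h. exact: h.
apply: (@leaf_ends_card 2 l x) => //.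
- by move=> i; rewrite /l; lia.
- by move=> i; rewrite /l; lia.
- move=> i k; have := heads i k; have h0 := x2 i 0%N isT; have h1 := x2 i 1%N isT.
  have ne : x i 0%N <> x i 1%N :> nat by move=> /val_inj e; have := xinj i 0%N 1%N isT isT e.
  move=> hk; have [e|e] := eqVneq (dir b (l i) k ord0) (x i 0%N).
    by exists 0%N.
  have e1 : dir b (l i) k (ord0 : label) = x i 1%N :> nat.
    by move: e; rewrite -val_eqE /=; lia.
  by exists 1%N => //; exact: val_inj.
- move=> i c c2; have := x2 i c c2; case e : (x i c : nat) => [|[|//]] _.
    by exists 0%N; apply: val_inj; rewrite /= e.
  by exists M; apply: val_inj; rewrite /= e d1.
- move=> i c c2; rewrite lE; apply: val_inj => /=.
  have x2c := x2 i c c2; have x2S := x2 i.+1 c c2.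
  rewrite (two i (x i.+1 c) x2S) /x /= -/(x i c) two//.
  by case: (s i) => /=; lia.
Qed.

End leaf_ends.

Local Close Scope ring_scope.

(** * Category, cardinality and uniqueness *)

Section final.
Variables (R : realType) (K : nat).
Local Notation S := (solenoid R K).
Local Notation X := (ws_limit S).
Local Notation Psi := (@Psi R K).
Local Notation leafset := (@leafset R K).

Definition sparse (N : nat) (b : nat -> bool) : Prop :=
  forall i, (N <= i)%N -> ~~ (b i && b i.+1).

(** Any open set contains a point whose sequence ends in ones. A neighbourhood of it fixes four
    consecutive ones beyond [N]; two representatives of a point differ in at most one bit, so one of
    the two disjoint pairs 11 survives. *)
Lemma sparse_nowhere_dense N : nowhere_dense
  [set p : X | exists b x, [/\ sparse N b, thick_piece K x & p = Psi b x]].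
Proof.
rewrite /nowhere_dense; set Z := (X in closure X).
rewrite -subset0 => p Zp; have [b [x [px pE]]] := Psi_rep p.
have tx := piece_thick px.
have [m [A [oA Ap AZ]]] := limit_nbhs (@bond_continuous R K) Zp.
pose m1 := maxn m N; pose b1 i := if (i < m1)%N then b i else true.
have Aq : A (val (Psi b1 x) m).
  rewrite Psi_coord; rewrite pE Psi_coord in Ap.
  rewrite (_ : prefix b1 m = prefix b m)//; apply: eq_prefix_lt => i im.
  by rewrite /b1 (leq_trans im (leq_maxl _ _)).
have Zq : closure Z (Psi b1 x) by exact: AZ.
pose Q := @pos R K _ (prefix b1 (m1 + 4)) @` (@thick_piece R K).
have oQ : open Q.
  apply: (psi_open (@actK K (m1 + 4)) _ (level_glued R K (m1 + 4))) => //.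
  exact: thick_piece_open.
have nQ : nbhs (Psi b1 x) [set q : X | Q (val q (m1 + 4)%N)].
  apply: (@limit_proj_continuous _ (@bond R K) (m1 + 4)); apply: open_nbhs_nbhs.
  by split=> //; exists x.
have [r [[b2 [y [sp ty rE]]] [z tz /esym zE]]] := Zq _ nQ.
have [c [/eq_prefix cE rc]] := Psi_lift tz zE.
have ones i : (m1 <= i < m1 + 4)%N -> c i = true.
  by move=> /andP[h1 h2]; rewrite cE// /b1 ltnNge h1.
rewrite rE in rc.
have [k kP] : exists k, forall i, i != k -> b2 i = c i.
  have [[-> _]|[j [_ _ ->]]] := (Psi_eq b2 c ty tz).1 rc; first by exists 0%N.
  by have [k kP] := actw_one_bit j b2; exists k => i /kP.
have N1 : (N <= m1)%N by exact: leq_maxr.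
have [k1|k1] := leqP k m1.+1.
  have := sp m1.+2 (leq_trans N1 (leqW (leqnSn _))).
  by rewrite !kP ?ones//; lia.
have := sp m1 N1.
by rewrite !kP ?ones//; lia.
Qed.

(** The sparse sets are intersected with [B] because [meager] asks for a union equal to [B]. *)
Lemma sparse_meager (B : set X) :
  (forall p, B p -> exists N b x, [/\ sparse N b, thick_piece K x & p = Psi b x]) ->
  meager B.
Proof.
move=> H; exists (fun N => B `&`
  [set p : X | exists b x, [/\ sparse N b, thick_piece K x & p = Psi b x]]).
  move=> N; rewrite /nowhere_dense -subset0 -(sparse_nowhere_dense N).
  by apply: interiorS; apply: closureS => p [].
apply/seteqP; split=> [p Bp|p [N _ []//]].
by have [N [b [x h]]] := H p Bp; exists N => //; split=> //; exists b, x.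
Qed.

Lemma leaf_with_endsP m L :
  leaf_with_ends S m L <-> exists2 b, L = leafset b & (ends (leaf_space (leafset b)) #= `I_m)%card.
Proof.
split=> [[/leafP[b ->] h]|[b -> h]]; first by exists b.
by split=> //; apply/leafP; exists b.
Qed.

Lemma not_one_sparse b : ~ (ends (leaf_space (leafset b)) #= `I_1)%card ->
  exists N, sparse N b.
Proof.
move=> h; apply: contrapT => ns; apply: h; apply: leaf_ends_one => m.
apply: contrapT => nb; apply: ns; exists m => i mi; apply/negP => bb.
by apply: nb; exists i.
Qed.

Lemma cofinal_sparse b b' N : cofinal b b' -> sparse N b -> exists N', sparse N' b'.
Proof.
move=> [m mP] sp; exists (maxn m N) => i; rewrite geq_max => /andP[mi Ni].
by rewrite !mP//; [exact: sp|exact: leqW].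
Qed.

Lemma one_end_residual : residual (\bigcup_(L in leaf_with_ends S 1) L).
Proof.
apply: sparse_meager => p np; have [b [x [px pE]]] := Psi_rep p.
have tx := piece_thick px; have [|N sp] := @not_one_sparse b; last by exists N, b, x.
move=> h; apply: np; exists (leafset b); first by apply/leaf_with_endsP; exists b.
by rewrite pE; apply: leafset_Psi => //; exact: cofinal_refl.
Qed.

Lemma two_ends_meager : meager (\bigcup_(L in leaf_with_ends S 2) L).
Proof.
apply: sparse_meager => p [_ /leaf_with_endsP[b -> e2] [b' [x [bb tx pE]]]].
have [e1|N sp] := @not_one_sparse b.
  have : (`I_2 #= `I_1)%card by apply: card_eq_trans e1; rewrite card_eq_sym.
  by move/card_eq_II.
by have [N' sp'] := cofinal_sparse bb sp; exists N', b', x.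
Qed.

(* Only the bits of rank q (K + 3) may be 1: they are for q even, while each [t i] is
   repeated at infinitely many odd q, so that cofinal sequences have the same t. *)
Definition coded (t : nat -> bool) (m : nat) : bool :=
  (K.+3 %| m) && (if odd (m %/ K.+3) then t (logn 2 (m %/ K.+3).+1).-1 else true).

Lemma codedM t q : coded t (q * K.+3) = if odd q then t (logn 2 q.+1).-1 else true.
Proof. by rewrite /coded dvdn_mull// mulnK. Qed.

Lemma coded_two_ends t : leaf_with_ends S 2 (leafset (coded t)).
Proof.
apply/leaf_with_endsP; exists (coded t) => //; apply: leaf_ends_two.
  by move=> i /negbTE; rewrite /coded => ->.
by move=> q /negbTE oq; rewrite codedM oq.
Qed.

Lemma coded_inj : injective (fun t => leafset (coded t)).
Proof.
move=> t t' /leafset_eq[m mP]; apply/funext => i.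
(* An odd q beyond the rank m, with q + 1 of 2-adic valuation i + 1, so that the bit at this block
   is the i-th term of the coded sequence. *)
pose q := (2 ^ i.+1 * (2 * m).+1).-1.
have q0 : (0 < 2 ^ i.+1 * (2 * m).+1)%N by rewrite muln_gt0 expn_gt0.
have qS : q.+1 = (2 ^ i.+1 * (2 * m).+1)%N by rewrite /q prednK.
have oq : odd q by rewrite -[odd q]negbK -oddS qS expnS -mulnA oddM.
have lq : (logn 2 q.+1).-1 = i.
  rewrite qS lognM ?expn_gt0// pfactorK// (_ : logn 2 (2 * m).+1 = 0%N) ?addn0//.
  by rewrite logn_coprime// coprime2n /= oddM.
have mq : (m <= q * K.+3)%N.
  have h : (q.+1 >= (2 * m).+1)%N by rewrite qS leq_pmull// expn_gt0.
  by apply: (@leq_trans q); [lia|exact: leq_pmulr].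
by have := mP _ mq; rewrite !codedM oq lq.
Qed.

(** Cantor's diagonal argument: [d] differs from every [t] at the index of the leaf of [t],
    including its own. *)
Lemma two_ends_uncountable : ~ countable (leaf_with_ends S 2).
Proof.
move=> /countable_injP[f f_inj].
have F_inj : injective (fun t => f (leafset (coded t))).
  by move=> t t' /f_inj e; apply: coded_inj; apply: e; rewrite inE; exact: coded_two_ends.
pose d n := ~~ xget (fun=> true) [set t | f (leafset (coded t)) = n] n.
have := erefl (d (f (leafset (coded d)))); rewrite {1}/d.
case: xgetP => [t _ /F_inj-> |/(_ d)]; last by case.
by case: (d _).
Qed.

(** By [leaf_ends_not] more than two ends force the sequence to be eventually 0, and all such
    sequences are cofinal. *)
Lemma many_ends_unique N : N = K.+3 -> exists! L, leaf_with_ends S N L.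
Proof.
move=> ->.
exists (leafset (fun=> false)); split.
  apply/leaf_with_endsP; exists (fun=> false) => //.
  by apply: leaf_ends_zero; exists 0%N.
move=> _ /leaf_with_endsP[b -> h]; apply: cofinal_leafset.
apply: contrapT => nc; apply: (leaf_ends_not _ _ h) => // m.
apply: contrapT => nb; apply: nc; exists m => i mi.
by apply/negP => bi; apply: nb; exists i.
Qed.

End final.

Theorem theorem1p1 (R : realType) (n : nat) (hn : (1 < n)%N) :
  exists S : weak_solenoid R,
    [/\ residual (\bigcup_(L in leaf_with_ends S 1) L),
        meager (\bigcup_(L in leaf_with_ends S 2) L),
        ~ countable (leaf_with_ends S 2) &
        exists! L : set (ws_limit S), leaf_with_ends S (2 * n) L].
Proof.
(* There are K + 3 labels; as n > 1 the truncated subtraction is exact and this number is 2n. *)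
exists (solenoid R (2 * n - 3)); split.
- exact: one_end_residual.
- exact: two_ends_meager.
- exact: two_ends_uncountable.
by apply: many_ends_unique; lia.
Qed.
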